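(* Suppose the Markov decision process described in the context satisfies conditions (G), (SU) and (M) stated there. Then the primal linear program (P) and the dual linear program (P$^*$) defined in the context satisfy the following: (i) (P) is consistent (it has a feasible solution) and solvable (it has an optimal solution), and (P$^*$) is consistent. (ii) There is no duality gap: $\inf(\mathrm{P}) = \sup(\mathrm{P}^* ) = \rho^*$.
   Context: MDP model. $\mathbb{X}$ (state space) is a Borel space, i.e., a separable metrizable space homeomorphic to a Borel subset of a Polish space. $\mathbb{A}$ (action space) is a countable set with the discrete topology. For a topological space $X$, $\mathcal{B}(X)$ is its Borel $\sigma$-algebra and $\mathcal{P}(X)$ the set of Borel probability measures; for $X$ a Borel space, $\mathcal{P}(X)$ carries the topology of weak convergence. Each $x\in\mathbb{X}$ has a nonempty set $A(x)\subset\mathbb{A}$ of admissible actions, and $\Gamma=\{(x,a): x\in\mathbb{X}, a\in A(x)\}$ is a Borel subset of $\mathbb{X}\times\mathbb{A}$. The state transition kernel $q(dy\,|\,x,a)$ is a Borel measurable stochastic kernel on $\mathbb{X}$ given $\mathbb{X}\times\mathbb{A}$ (i.e., a Borel measurable map into $\mathcal{P}(\mathbb{X})$). The one-stage cost $c:\mathbb{X}\times\mathbb{A}\to[0,+\infty]$ is Borel measurable, real-valued on $\Gamma$ and equal to $+\infty$ outside $\Gamma$; its restriction to $\Gamma$ is also denoted $c$. Policies and average cost. A policy is a sequence $\pi=(\mu_0,\mu_1,\ldots)$ where $\mu_n(da_n\,|\,x_0,a_0,\ldots,a_{n-1},x_n)$ is a Borel measurable stochastic kernel on $\mathbb{A}$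 given $(\mathbb{X}\times\mathbb{A})^n\times\mathbb{X}$ with $\mu_n(A(x_n)\,|\,x_0,a_0,\ldots,a_{n-1},x_n)=1$ everywhere; $\Pi$ is the set of all policies. A policy $\pi$ and an initial distribution $\zeta\in\mathcal{P}(\mathbb{X})$, together with $q$, determine the law of the process $\{(x_n,a_n)\}_{n\ge0}$, with expectation $\mathbf{E}^\pi_\zeta$. The average cost is $J(\pi,\zeta)=\limsup_{n\to\infty} n^{-1}\mathbf{E}^\pi_\zeta\big[\sum_{k=0}^{n-1}c(x_k,a_k)\big]$, and $\rho^*=\inf_{\zeta\in\mathcal{P}(\mathbb{X})}\inf_{\pi\in\Pi}J(\pi,\zeta)$. Conditions. (G) For some $\pi\in\Pi$ and $\zeta\in\mathcal{P}(\mathbb{X})$, $J(\pi,\zeta)<\infty$. (SU) There is a nondecreasing sequence of compact sets $\Gamma_j\uparrow\Gamma$ such that $\lim_{j\to\infty}\inf_{(x,a)\in\Gamma_j^c}c(x,a)=+\infty$ (complement in $\mathbb{X}\times\mathbb{A}$). (M) With $\Gamma_j$ as in (SU), for each compact set $K\in\{\mathrm{proj}_{\mathbb{X}}(\Gamma_j)\}$ (projections of the $\Gamma_j$ on $\mathbb{X}$) there exist an open set $O\supset K$, a closed set $D\subset\mathbb{X}$ (possibly empty) and a finite measure $\nu$ on $\mathcal{B}(\mathbb{X})$, all possibly depending on $K$, such that $q\big((O\setminus D)\cap B\,|\,x,a\big)\le\nu(B)$ for all $B\in\mathcal{B}(\mathbb{X})$ and $(x,a)\in\Gamma$, and such that,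 restricted to $D\times\mathbb{A}$, the kernel $q(dy\,|\,x,a)$ is continuous (as a map into $\mathcal{P}(\mathbb{X})$) and $c(x,a)$ is lower semicontinuous. Linear programs. Let $w=1+c$ on $\Gamma$. $\mathbb{M}_w(\Gamma)$ is the set of finite signed Borel measures $\gamma$ on $\Gamma$ with $\int w\,d|\gamma|<\infty$, and $\mathbb{M}^+_w(\Gamma)$ is its subset of nonnegative measures. $\mathbb{F}_b(\mathbb{X})$ is the set of bounded real-valued Borel measurable functions on $\mathbb{X}$. $\hat\gamma$ is the marginal of $\gamma$ on $\mathbb{X}$, and $\langle\gamma,c\rangle=\int_\Gamma c\,d\gamma$. (P): minimize $\langle\gamma,c\rangle$ over $\gamma\in\mathbb{M}_w^+(\Gamma)$ subject to $\gamma(\Gamma)=1$ and $\hat\gamma(B)=\int_\Gamma q(B\,|\,x,a)\,\gamma(d(x,a))$ for all $B\in\mathcal{B}(\mathbb{X})$. (P$^*$): maximize $\rho$ over $(\rho,h)\in\mathbb{R}\times\mathbb{F}_b(\mathbb{X})$ subject to $\rho+h(x)-\int_{\mathbb{X}}h(y)\,q(dy\,|\,x,a)\le c(x,a)$ for all $(x,a)\in\Gamma$. $\inf(\mathrm{P})$ and $\sup(\mathrm{P}^* )$ denote the optimal values of these programs. *)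

(* Defs.v *)
From HB Require Import structures.
From mathcomp Require Import all_boot all_order all_algebra.
From mathcomp Require Import all_classical all_reals all_analysis.
From mathcomp Require Import measurable_realfun.
Import Order.TTheory GRing.Theory Num.Theory.
Import numFieldNormedType.Exports.

Set Implicit Arguments.
Unset Strict Implicit.
Unset Printing Implicit Defensive.

Local Open Scope classical_set_scope.
Local Open Scope ring_scope.

(* Topological spaces whose measurable sets are the Borel sets. The library's
   [measurableType]s are pointed; the state and action spaces of a Markov
   decision process with at least one initial distribution are non-empty. *)
HB.mixin Record isBorelMeasurable (d : measure_display) T
    & Measurable d T & Topological T := {
  borelE : @measurable d T = <<s @open T >>
}.

#[short(type="borelType")]
HB.structure Definition BorelMeasurable d :=
  {T of Measurable d T & Topological T & isBorelMeasurable d T}.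

#[short(type="completeMetricType")]
HB.structure Definition CompleteMetric (R : numDomainType) :=
  {T of Complete T & Metric R T}.

Section borel_spaces.
Context (R : realType).

Definition separable (T : topologicalType) :=
  exists2 S : set T, countable S & dense S.

Definition homeomorphic_to (T U : topologicalType) (B : set U) :=
  exists (f : T -> U) (g : U -> T),
    [/\ continuous f, {within B, continuous g},
        (forall x, B (f x)), cancel f g & (forall y, B y -> f (g y) = y)].

Definition metrizable (T : topologicalType) :=
  exists M : metricType R, homeomorphic_to T [set: M].

Definition borel_space (T : topologicalType) :=
  [/\ separable T, metrizable T &
      exists (P : completeMetricType R) (B : set P),
        [/\ separable P, <<s @open P >> B & homeomorphic_to T B]].

End borel_spaces.

Section weak_convergence.
Context d (X : borelType d) (R : realType).

Definition bounded_continuous : Type :=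
  {f : X -> R | continuous f /\ exists M, forall x, `|f x| <= M}.

Definition wc_eval (mu : probability X R) : {ptws bounded_continuous -> R} :=
  fun f => (\int[mu]_x sval f x)%R.

(* P(X) with the topology of weak convergence, i.e., the coarsest topology
   making all the maps mu |-> \int f dmu continuous, f bounded continuous *)
Definition prob_wc := initial_topology wc_eval.
HB.instance Definition _ := Topological.on prob_wc.

End weak_convergence.

Section kernel_constructions.
Context d d1 d2 (T : measurableType d) (T1 : measurableType d1)
  (T2 : measurableType d2) (R : realType).

Definition pker_at (k : R.-pker T1 ~> T2) (x : T1) : set T2 -> \bar R := k x.
HB.instance Definition _ k x := Measure.on (pker_at k x).
HB.instance Definition _ k x :=
  Measure_isProbability.Build _ _ _ (pker_at k x) (prob_kernel x).

Definition kpullback (f : T -> T1) (_ : measurable_fun [set: T] f)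
  (k : R.-pker T1 ~> T2) : T -> {measure set T2 -> \bar R} := k \o f.

Section kpullback.
Variables (f : T -> T1) (mf : measurable_fun [set: T] f) (k : R.-pker T1 ~> T2).

Let kpullback_measurable U : measurable U ->
  measurable_fun [set: T] (kpullback mf k ^~ U).
Proof.
move=> mU; have mk := measurable_kernel k U mU.
exact: (measurableT_comp mk mf).
Qed.

HB.instance Definition _ :=
  isKernel.Build _ _ _ _ _ (kpullback mf k) kpullback_measurable.

Let kpullback_prob x : kpullback mf k x [set: T2] = 1%E.
Proof. exact: prob_kernel. Qed.

HB.instance Definition _ :=
  Kernel_isProbability.Build _ _ _ _ _ (kpullback mf k) kpullback_prob.
End kpullback.

(* the law P(dx) k(dy|x) on T1 * T2 *)
Definition pprod_kernel (P : probability T1 R) (k : R.-pker T1 ~> T2)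
  (B : set (T1 * T2)) : \bar R := (\int[P]_x k x (xsection B x))%E.

Section pprod_kernel.
Variables (P : probability T1 R) (k : R.-pker T1 ~> T2).
Local Notation m := (pprod_kernel P k).

Let m0 : m set0 = 0%E.
Proof. by apply: integral0_eq => x _; rewrite xsection0 measure0. Qed.

Let m_ge0 B : (0 <= m B)%E.
Proof. by apply: integral_ge0 => x _; exact: measure_ge0. Qed.

Let m_sigma_additive : semi_sigma_additive m.
Proof.
move=> F mF tF mUF.
have mk n : measurable_fun [set: T1] (fun x => k x (xsection (F n) x)).
  by apply: (measurable_fun_xsection_finite_kernel k); rewrite inE.
rewrite [X in _ --> X](_ : _ =
    \int[P]_x \sum_(0 <= n <oo) k x (xsection (F n) x))%E; last first.
  apply: eq_integral => x _; rewrite xsection_bigcup measure_semi_bigcup//.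
  - by move=> n; exact: measurable_xsection.
  - exact: trivIset_xsection.
  - by rewrite -xsection_bigcup; exact: measurable_xsection.
rewrite integral_nneseries//.
by apply: is_cvg_nneseries => n _ _; exact: m_ge0.
Qed.

HB.instance Definition _ := isMeasure.Build _ _ _ m m0 m_ge0 m_sigma_additive.

Let mT : m [set: _] = 1%E.
Proof.
rewrite /pprod_kernel.
under eq_integral do rewrite xsectionE preimage_setT prob_kernel.
by rewrite integral_cst// mul1e; exact: probability_setT.
Qed.

HB.instance Definition _ := Measure_isProbability.Build _ _ _ m mT.
End pprod_kernel.

End kernel_constructions.

(* The Borel sigma-algebra of X * A is the product sigma-algebra, since X and A
   are second countable; likewise for the spaces of histories below. *)
Record mdp (R : realType) (dX dA : measure_display)
    (X : borelType dX) (A : borelType dA) := MDP {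
  adm : X -> set A ;
  adm_neq0 : forall x, adm x !=set0 ;
  graph : set (X * A) := [set z | adm z.1 z.2] ;
  graph_measurable : measurable graph ;
  trans : R.-pker (X * A) ~> X ;
  cost : X * A -> \bar R ;
  cost_ge0 : forall z, (0 <= cost z)%E ;
  cost_measurable : measurable_fun [set: X * A] cost ;
  cost_fin : forall z, graph z -> (cost z < +oo)%E ;
  cost_out : forall z, ~ graph z -> cost z = +oo%E
}.

Section policies.
Context (R : realType) (dX dA : measure_display).
Context (X : borelType dX) (A : borelType dA) (m : mdp R X A).

Fixpoint hist_disp (n : nat) : measure_display :=
  if n is n'.+1 then ((hist_disp n', dA).-prod, dX).-prod%mdisp else dX.

(* hist n is the space of histories (x_0, a_0, ..., a_(n-1), x_n), nested to
   the left *)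
Fixpoint hist (n : nat) : measurableType (hist_disp n) :=
  match n with
  | 0 => X
  | n'.+1 => (hist n' * A * X)%type
  end.

Definition hstate (n : nat) : hist n -> X :=
  match n with 0 => fun h => h | _.+1 => fun h => h.2 end.

Lemma measurable_hstate n : measurable_fun [set: hist n] (@hstate n).
Proof. by case: n => [|n]; [exact: measurable_id|exact: measurable_snd]. Qed.

Definition hstep (n : nat) (z : hist n * A) : X * A := (hstate z.1, z.2).

Lemma measurable_hstep n : measurable_fun [set: hist n * A] (@hstep n).
Proof.
apply: measurable_fun_pair; last exact: measurable_snd.
exact: (measurableT_comp (@measurable_hstate n) measurable_fst).
Qed.

Record policy := Policy {
  decision : forall n, R.-pker (hist n) ~> A ;
  decision_adm : forall n (h : hist n), decision n h (adm m (hstate h)) = 1%E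
}.

(* law of (x_0, a_0, ..., a_(n-1), x_n) *)
Fixpoint hist_law (pi : policy) (zeta : probability X R) (n : nat) :
    probability (hist n) R :=
  match n with
  | 0 => zeta
  | n'.+1 => pprod_kernel (pprod_kernel (hist_law pi zeta n') (decision pi n'))
                          (kpullback (@measurable_hstep n') (trans m))
  end.

(* \sum_(0 <= k < n) c(x_k, a_k) *)
Fixpoint total_cost (n : nat) : hist n -> \bar R :=
  match n with
  | 0 => fun=> 0%E
  | n'.+1 => fun h => (total_cost h.1.1 + cost m (hstep h.1))%E
  end.

Definition average_cost (pi : policy) (zeta : probability X R) : \bar R :=
  limn_esup (fun n => (n%:R^-1)%:E * \int[hist_law pi zeta n]_h total_cost h)%E.

Definition optimal_average_cost : \bar R :=
  ereal_inf [set ereal_inf [set average_cost pi zeta | pi in [set: policy]]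
            | zeta in [set: probability X R]].

End policies.

Section conditions.
Context (R : realType) (dX dA : measure_display).
Context (X : borelType dX) (A : borelType dA) (m : mdp R X A).

Definition condG :=
  exists (pi : policy m) (zeta : probability X R),
    (average_cost pi zeta < +oo)%E.

Definition condSU (G_ : nat -> set (X * A)) :=
  [/\ forall j, compact (G_ j),
      forall i j, (i <= j)%N -> G_ i `<=` G_ j,
      \bigcup_j G_ j = graph m &
      ereal_inf (cost m @` ~` G_ j) @[j --> \oo] --> +oo%E].

Definition condM (G_ : nat -> set (X * A)) :=
  forall j, exists (O D : set X) (nu : {finite_measure set X -> \bar R}),
    [/\ open O /\ fst @` G_ j `<=` O,
        closed D,
        (forall B z, measurable B -> graph m z ->
          (trans m z ((O `\` D) `&` B) <= nu B)%E),
        {within D `*` [set: A], continuous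
          (fun z => pker_at (trans m) z : prob_wc X R)} &
        lower_semicontinuous (cost m : subspace (D `*` [set: A]) -> \bar R)].

End conditions.

Section linear_programs.
Context (R : realType) (dX dA : measure_display).
Context (X : borelType dX) (A : borelType dA) (m : mdp R X A).
Local Open Scope ereal_scope.

(* Finite measures on Gamma are encoded as finite measures on X * A that do not
   charge the complement of Gamma. *)
Definition Mw_pos : set {finite_measure set (X * A)%type -> \bar R} :=
  [set g | g (~` graph m) = 0 /\
           \int[g]_(z in graph m) (1 + cost m z) < +oo].

Definition primal_feasible : set {finite_measure set (X * A)%type -> \bar R} :=
  [set g | [/\ Mw_pos g, g (graph m) = 1 &
     forall B : set X, measurable B ->
       pushforward g fst B = \int[g]_(z in graph m) trans m z B]].

Definition primal_value (g : {finite_measure set (X * A)%type -> \bar R}) : \bar R :=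
  \int[g]_(z in graph m) cost m z.

Definition primal_optimal (g : {finite_measure set (X * A)%type -> \bar R}) :=
  primal_feasible g /\
  forall g', primal_feasible g' -> primal_value g <= primal_value g'.

Definition inf_primal : \bar R := ereal_inf (primal_value @` primal_feasible).

Definition dual_feasible : set (R * (X -> R))%type :=
  [set rh : R * (X -> R) | [/\ measurable_fun [set: X] rh.2,
     (exists M : R, forall x, (`|rh.2 x| <= M)%R) &
     forall z, graph m z ->
       rh.1%:E + (rh.2 z.1)%:E - \int[trans m z]_y (rh.2 y)%:E <= cost m z]].

Definition sup_dual : \bar R := ereal_sup [set rh.1%:E | rh in dual_feasible].

End linear_programs.

(* Main.v *)
Require Import Defs.
From HB Require Import structures.
From mathcomp Require Import all_boot all_order all_algebra.
From mathcomp Require Import all_classical all_reals all_analysis.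
From mathcomp Require Import measurable_realfun.
From mathcomp Require Import lra.
Import Order.TTheory GRing.Theory Num.Theory.
Import numFieldNormedType.Exports.

(** Everything coincides because of a cycle of three inequalities: some feasible
    measure has primal value at most the supremum of the dual program, this
    supremum is at most the optimal average cost, and the optimal average cost
    is at most the primal value of every feasible measure. In particular the
    measure of the first step is optimal.

    Dual supremum at most optimal average cost
    ([sup_dual_le_optimal_average_cost]). If [(rho, h)] is dual feasible, then
    along any policy [rho + h x_n] is at most the conditional expectation of the
    [n]th cost plus [h x_(n+1)]. Summing over [n] stages, [n * rho] is at most
    the expected total cost up to a bounded term; divide by [n].

    Optimal average cost at most primal values
    ([optimal_average_cost_le_primal]). A feasible measure [g] disintegrates
    into its marginal on the states and a kernel on the actions
    ([disintegration]: one Radon-Nikodym derivative per action). Under the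
    stationary policy given by this kernel, started from the marginal, every
    pair [(x_n, a_n)] has law [g], so that the average cost is the primal value.

    A feasible measure below the dual supremum ([primal_attains_sup_dual]). The
    absence of a duality gap comes from dynamic programming, in place of a
    separation argument. Let [v_n] be the optimal [n]-stage cost, for the cost
    truncated at some level. By the Bellman equation the average [h] of
    [v_0, ..., v_(n-1)], together with any [rho] below [v_n / n], is dual
    feasible ([value_dual_feasible]). Hence [v_n / n] comes arbitrarily close
    to, or below, the dual supremum at some state, and playing almost optimally
    from there for [n] stages yields an occupation measure that is invariant up
    to [1 / n] and whose truncated cost exceeds the dual supremum by at most
    [2 / n] ([near_optimal_occupation]).

    It remains to let [n] tend to infinity although the transition kernel is
    discontinuous. The setwise limit of the occupation measures along a free
    ultrafilter is only finitely additive, but it is tight, because the cost is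
    large off compact sets. Caratheodory's construction, started from the
    compact sets, produces a probability measure [g] that dominates the limit on
    closed sets ([content_measure_exists]). By [condM] the state marginal
    of the limit is dominated by a finite measure on a neighbourhood of each
    compact projection, minus a closed set [D]. Finite measures are inner
    regular with respect to closed sets, so [g] also dominates the limit on
    sets that are closed only over each [D] ([piecewise_closed_le]). The
    superlevel sets of [z |-> \int[q z]_y v y] for a continuous [v], where [q]
    is the transition kernel, and the sublevel sets of the cost are of this
    kind; the layer-cake formula ([limit_integral_le]) then transfers the
    approximate invariance and the cost bound to [g]. *)

Set Implicit Arguments.
Unset Strict Implicit.
Unset Printing Implicit Defensive.

Local Open Scope classical_set_scope.
Local Open Scope ring_scope.

(** * Metrizable spaces and regularity of Borel measures *)
Section metrizable_spaces.
Context (R : realType).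

Definition closed_Gdelta (T : topologicalType) := forall F : set T, closed F ->
  exists2 G : (set T)^nat, (forall n, open (G n)) & F = \bigcap_n G n.

(** A closed set is the intersection of its open neighbourhoods of radius
    [1 / n.+1]. *)
Lemma pseudometric_closed_Gdelta (M : pseudoMetricType R) : closed_Gdelta M.
Proof.
move=> F cF; exists (fun n => \bigcup_(x in F) (ball x n.+1%:R^-1)^°).
  by move=> n; apply: bigcup_open => x _; exact: open_interior.
apply/seteqP; split=> [x Fx n _|x Fx].
  exists x => //; rewrite /interior/=; apply: nbhsx_ballx.
  by rewrite invr_gt0.
rewrite (closure_id F).1//; move=> B /nbhs_ballP[e /= e0 eB].
have [n ne] : exists n, n.+1%:R^-1 < e.
  have [n _ /(_ n (leqnn n))] := near_infty_natSinv_lt (PosNum e0).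
  by exists n.
have [y Fy /interior_subset yx] := Fx n I.
exists y; split => //; apply: eB; apply: ball_sym.
by apply: le_ball yx; exact: ltW.
Qed.

(** The only topological facts about the state space that the proof uses. They
    are transported along the homeomorphism because a metrizable space carries
    no metric structure of its own. *)
Lemma metrizable_separation (T : topologicalType) : metrizable R T ->
  [/\ hausdorff_space T, normal_space T & closed_Gdelta T].
Proof.
case=> M [f [g [cf cg _ fK gK]]].
have cg' : continuous g by apply/continuous_subspace_setT.
have closed_g (F : set T) : closed F -> closed (g @^-1` F).
  by move=> cF; apply: closed_comp => // x _; exact: cg'.
have open_f (G : set M) : open G -> open (f @^-1` G).
  by move=> oG; apply: open_comp => // x _; exact: cf.
split.
- rewrite open_hausdorff => x y xy.
  have := @metric_hausdorff R M; rewrite open_hausdorff.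
  case/(_ (f x) (f y)); first by apply: contra xy => /eqP/(can_inj fK)->.
  move=> [U V] /= [xU yV] [oU oV UV].
  exists (f @^-1` U, f @^-1` V) => /=; first by rewrite !inE in xU yV *.
  by split; [exact: open_f|exact: open_f|rewrite -preimage_setI (eqP UV)].
- apply/(@normal_openP R) => A B cA cB AB.
  have := (@normal_openP R M).1 (@pseudometric_normal R M) _ _
    (closed_g _ cA) (closed_g _ cB).
  rewrite -preimage_setI AB preimage_set0 => /(_ erefl)[U [V [oU oV AU BV UV]]].
  exists (f @^-1` U), (f @^-1` V); split; [exact: open_f|exact: open_f| | |].
  + by move=> x Ax; apply: AU; rewrite /= fK.
  + by move=> x Ax; apply: BV; rewrite /= fK.
  + by rewrite -preimage_setI UV preimage_set0.
- move=> F /closed_g/(pseudometric_closed_Gdelta)[G oG FG].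
  exists (fun n => f @^-1` (G n)); first by move=> n; exact: open_f.
  by rewrite -preimage_bigcap -FG -comp_preimage; apply/seteqP; split=> x /=;
    rewrite fK.
Qed.

End metrizable_spaces.

Section borel_regularity.
Context d (T : borelType d) (R : realType).
Hypothesis GdeltaT : closed_Gdelta T.

Lemma open_borel (G : set T) : open G -> measurable G.
Proof. by move=> oG; rewrite borelE; exact: sub_sigma_algebra. Qed.

Lemma closed_borel (F : set T) : closed F -> measurable F.
Proof.
by move=> cF; rewrite -(setCK F); apply/measurableC/open_borel/closed_openC.
Qed.

Lemma continuous_borel (v : T -> R) : continuous v -> measurable_fun [set: T] v.
Proof.
move=> cv; apply: measurability (RGenOpens.measurableE R) _.
move=> _ [_ [a [b ->] <-]]; rewrite setTI; apply: open_borel.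
by apply: open_comp => // x _; exact: cv.
Qed.

Local Open Scope ereal_scope.

(** Continuity from above, in the form used to cut an infinite operation down to
    a finite one at small cost. *)
Lemma nonincreasing_measure_le (mu : {finite_measure set T -> \bar R})
    (F : (set T)^nat) (e : \bar R) :
  (forall n, measurable (F n)) -> nonincreasing_seq F ->
  mu (\bigcap_n F n) < e -> exists n, mu (F n) < e.
Proof.
move=> mF niF lte.
have cF : mu (F n) @[n --> \oo] --> mu (\bigcap_n F n).
  apply: nonincreasing_cvg_mu => //; last exact: bigcapT_measurable.
  by rewrite -ge0_fin_numE// fin_num_measure.
have : \forall n \near \oo, mu (F n) < e.
  by apply: (cF [set x | x < e]); apply: open_nbhs_nbhs; split=> //; exact: open_ereal_lt_ereal.
by case=> n _ /(_ n (leqnn n)); exists n.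
Qed.

Definition regular_set (mu : set T -> \bar R) (B : set T) :=
  forall e : R, (0 < e)%R -> exists F G,
    [/\ closed F, open G, F `<=` B, B `<=` G & mu (G `\` F) < e%:E].

Lemma closed_regular (mu : {finite_measure set T -> \bar R}) F :
  closed F -> regular_set mu F.
Proof.
move=> cF e e0; have [G oG FG] := GdeltaT cF.
pose H n := \big[setI/setT]_(i < n.+1) G i.
have oH n : open (H n).
  by rewrite /H; elim/big_ind: _ => //; [exact: openT|exact: openI].
have FH n : F `<=` H n.
  by rewrite /H -bigcap_mkord FG => x Fx i _; exact: Fx.
have [||| n Hn] := @nonincreasing_measure_le mu (fun n => H n `\` F) e%:E.
- by move=> n; apply: measurableD; [exact: open_borel|exact: closed_borel].
- move=> i j ij; apply/subsetPset => x [Hx nFx]; split=> //.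
  move: Hx; rewrite /H -!bigcap_mkord => Hx k /= ki; apply: Hx => /=.
  exact: leq_trans ki _.
- rewrite (_ : \bigcap_n _ = set0) ?measure0//; apply/seteqP; split=> // x Hx.
  have [_ +] := Hx 0%N I; apply; rewrite FG => n _.
  have [+ _] := Hx n I; rewrite /H -bigcap_mkord; apply => /=.
  exact: ltnSn.
- by exists F, (H n); split.
Qed.

(** Closed sets are regular since they are countable intersections of open sets.
    Asking for an approximation from both sides makes the class of regular sets
    stable under complement; for a countable union, finitely many of the inner
    approximations suffice. *)
Lemma borel_regular (mu : {finite_measure set T -> \bar R}) B :
  measurable B -> regular_set mu B.
Proof.
rewrite borelE; move: B; apply: smallest_sub; last first.
  move=> G oG e e0.
  have [F [H [cF oH FG GH Fe]]] := closed_regular mu (open_closedC oG) e0.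
  exists (~` H), (~` F); split; [exact: open_closedC|exact: closed_openC| | |].
  - by rewrite -(setCK G); exact: subsetC.
  - by rewrite -(setCK G); exact: subsetC.
  - by rewrite setDE setCK setIC.
split.
- by apply: closed_regular; exact: closed0.
- move=> A rA e e0; have [F [H [cF oH FA AH Fe]]] := rA _ e0.
  exists (~` H), (~` F); rewrite setTD.
  split; [exact: open_closedC|exact: closed_openC|exact: subsetC|exact: subsetC|].
  by rewrite setDE setCK setIC.
move=> A rA e e0.
have e20 : (0 < e / 2)%R by rewrite divr_gt0.
have /choice[F /choice[G FG]] : forall n, exists F, exists G,
    [/\ closed F, open G, F `<=` A n, A n `<=` G &
    mu (G `\` F) < (e / 2 / (2 ^ n.+1)%:R)%:E].
  by move=> n; apply: rA; rewrite !divr_gt0.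
have cF n : closed (F n) by have [] := FG n.
have oG n : open (G n) by have [] := FG n.
have mF n : measurable (F n) by exact: closed_borel.
have mG n : measurable (G n) by exact: open_borel.
pose GT := \bigcup_n G n.
have [||| n Hn] := @nonincreasing_measure_le mu
    (fun n => GT `\` \big[setU/set0]_(i < n) F i) e%:E.
- move=> n; apply: measurableD; first exact: bigcupT_measurable.
  exact: bigsetU_measurable.
- move=> i j ij; apply/subsetPset; apply: setDS.
  exact: subset_bigsetU.
- apply: (@le_lt_trans _ _ (mu (\bigcup_n (G n `\` F n)))).
    apply: le_measure; rewrite ?inE.
    + apply: bigcapT_measurable => n; apply: measurableD.
        exact: bigcupT_measurable.
      exact: bigsetU_measurable.
    + by apply: bigcupT_measurable => n; exact: measurableD.
    + move=> x Hx; have [[k _ Gkx] _] := Hx 0%N I.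
      exists k => //; split=> // Fkx.
      have [_ +] := Hx k.+1 I; apply; rewrite -bigcup_mkord.
      by exists k => //=.
  apply: (@le_lt_trans _ _ (\sum_(n <oo) mu (G n `\` F n))).
    apply: generalized_Boole_inequality => [n|]; first exact: measurableD.
    by apply: bigcupT_measurable => n; exact: measurableD.
  apply: (@le_lt_trans _ _ (\sum_(n <oo) (0 + (e / 2 / (2 ^ n.+1)%:R)%:E))).
    apply: lee_nneseries => k _; first by [].
    by rewrite add0e ltW//; have [] := FG k.
  apply: le_lt_trans (epsilon_trick _ _ _) _ => //; first exact: ltW.
  by rewrite eseries0// add0e lte_fin; lra.
- exists (\big[setU/set0]_(i < n) F i), GT; split=> //.
  + by apply: closed_bigsetU => i _.
  + exact: bigcup_open.
  + rewrite -bigcup_mkord => x [k _ Fx]; exists k => //.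
    by have [_ _ + _ _] := FG k; exact.
  + by apply: subset_bigcup => k _; have [_ _ _ + _] := FG k.
Qed.

Lemma closed_inner_regular (mu : {finite_measure set T -> \bar R}) B (e : R) :
  measurable B -> (0 < e)%R ->
  exists F, [/\ closed F, F `<=` B & mu (B `\` F) <= e%:E].
Proof.
move=> mB e0; have [F [G [cF oG FB BG Fe]]] := borel_regular mu mB e0.
exists F; split=> //; apply: le_trans (ltW Fe); apply: le_measure.
- by rewrite inE; apply: measurableD => //; exact: closed_borel.
- by rewrite inE; apply: measurableD; [exact: open_borel|exact: closed_borel].
- exact: setSD.
Qed.

Hypothesis normT : normal_space T.

(** Let [F] be closed and let [F'] be a closed part of its complement that
    carries almost all the mass of [nu] there. A Urysohn function for this pair
    gives [mu F <= nu F] up to [e]; inner regularity passes from closed sets to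
    Borel sets. *)
Lemma le_measure_continuous (mu nu : {finite_measure set T -> \bar R}) :
  (forall v : T -> R, continuous v -> (forall x, 0 <= v x <= 1)%R ->
    \int[mu]_x (v x)%:E <= \int[nu]_x (v x)%:E) ->
  forall B, measurable B -> mu B <= nu B.
Proof.
move=> H.
have Hc (F : set T) : closed F -> mu F <= nu F.
  move=> cF; apply/lee_addgt0Pr => e e0.
  have mF := closed_borel cF.
  have [F' [cF' F'F F'e]] := closed_inner_regular nu (measurableC mF) e0.
  have mF' := closed_borel cF'.
  have F'F0 : F' `&` F = set0 by apply/disjoints_subset.
  have := (@normal_separatorP R T).1 normT _ _ cF' cF F'F0.
  move=> /(@uniform_separatorP T R)[v [cv v01 v0 v1]].
  (* As [v] is [0] on [F'] and [1] on [F], \1_F <= v <= \1_(~` F'). *)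
  have {}v01 x : (0 <= v x <= 1)%R.
    by have := v01 (v x) (imageT v x); rewrite /= in_itv.
  have mv : measurable_fun [set: T] (fun x => (v x)%:E).
    by apply/measurable_EFinP; exact: continuous_borel.
  apply: (@le_trans _ _ (\int[mu]_x (v x)%:E)).
    rewrite -(setIT F) -integral_indic//.
    apply: ge0_le_integral => //.
      by apply/measurable_EFinP; exact: measurable_indic.
    move=> x _; rewrite lee_fin indicE; have [/[!inE] Fx|_] := boolP (x \in F); last first.
      by case/andP: (v01 x).
    by have -> : v x = 1%R by apply: v1; exists x.
  apply: (le_trans (H _ cv v01)).
  apply: (@le_trans _ _ (nu (~` F'))).
    rewrite -(setIT (~` F')) -integral_indic//; last exact: measurableC.
    apply: ge0_le_integral => //.
    - by move=> x _; rewrite lee_fin; case/andP: (v01 x).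
    - by apply/measurable_EFinP/measurable_indic/measurableC.
    move=> x _; rewrite lee_fin indicE; have [_|] := boolP (x \in ~` F').
      by case/andP: (v01 x).
    rewrite notin_setE/= => /contrapT F'x.
    by have -> : v x = 0%R by apply: v0; exists x.
  rewrite -(setUIDK (~` F') F) measureU//; last 3 first.
  - by apply: measurableI => //; exact: measurableC.
  - by apply: measurableD => //; exact: measurableC.
  - by rewrite setDE setIACA setICr setI0.
  apply: leeD.
    apply: le_measure; rewrite ?inE//.
    by apply: measurableI => //; exact: measurableC.
  apply: le_trans F'e; apply: le_measure; rewrite ?inE.
  - by apply: measurableD => //; exact: measurableC.
  - by apply: measurableD => //; exact: measurableC.
  - by move=> x [? ?].
move=> B mB; apply/lee_addgt0Pr => e e0.
have [F [cF FB Fe]] := closed_inner_regular mu mB e0.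
have mF := closed_borel cF.
rewrite -(setDUK FB) measureU//; [|exact: measurableD|exact: setDIK].
apply: leeD => //; apply: (le_trans (Hc _ cF)).
by apply: le_measure; rewrite ?inE//; rewrite setDUK.
Qed.

End borel_regularity.

(** * Product with a countable discrete space *)
Section countable_discrete_factor.
Context (dX dA : measure_display) (X : borelType dX) (A : borelType dA).
Hypothesis countA : countable [set: A].
Hypothesis discA : forall B : set A, open B.

Lemma discrete_measurable (B : set A) : measurable B.
Proof. exact: open_borel. Qed.

Lemma bigcup_ysection (G : set (X * A)) :
  G = \bigcup_a (ysection G a `*` [set a]).
Proof.
apply/seteqP; split=> [[x a] Gxa|[x a] [b _ /= [+ ->]]].
  by exists a => //; split=> //; rewrite /= ysectionE.
by rewrite ysectionE.
Qed.

(** Only countably many sections have to be glued. This and its topological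
    analogue [open_ysections] reduce the product to the first factor. *)
Lemma measurable_ysections (G : set (X * A)) :
  (forall a, measurable (ysection G a)) -> measurable G.
Proof.
move=> mG; rewrite (bigcup_ysection G).
apply: countable_bigcupT_measurable => // a.
by apply: measurableX => //; exact: discrete_measurable.
Qed.

Lemma continuous_pair (a : A) : continuous (fun x : X => (x, a)).
Proof. by move=> x; apply: cvg_pair => //; exact: cvg_cst. Qed.

Lemma open_ysection (G : set (X * A)) a : open G -> open (ysection G a).
Proof.
move=> oG; rewrite ysectionE.
by apply: (open_comp (f := fun x : X => (x, a))) => // x _; exact: continuous_pair.
Qed.

Lemma closed_ysection (G : set (X * A)) a : closed G -> closed (ysection G a).
Proof.
move=> oG; rewrite ysectionE.
by apply: (closed_comp (f := fun x : X => (x, a))) => // x _; exact: continuous_pair.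
Qed.

Lemma open_setX1 (U : set X) (B : set A) : open U -> open (U `*` B).
Proof.
move=> oU; rewrite (_ : U `*` B = fst @^-1` U `&` snd @^-1` B)//.
by apply: openI; apply: open_comp => // z _; [exact: cvg_fst|exact: cvg_snd].
Qed.

Lemma open_ysections (G : set (X * A)) :
  (forall a, open (ysection G a)) -> open G.
Proof.
move=> oG; rewrite (bigcup_ysection G); apply: bigcup_open => a _.
exact: open_setX1.
Qed.

(** The first factor may fail to be second countable: countability of the
    discrete factor alone makes every open set a countable union of open
    rectangles, one for each section. *)
Lemma measurable_prod_open : @measurable _ (X * A)%type = <<s @open (X * A)%type >>.
Proof.
apply/seteqP; split; last first.
  apply: smallest_sub; first exact: sigma_algebra_measurable.
  move=> G oG; apply: measurable_ysections => a; apply: open_borel.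
  exact: open_ysection.
apply: smallest_sub; first exact: smallest_sigma_algebra.
(* The product sigma-algebra is generated by the preimages of Borel sets under
   the projections. *)
have saO : sigma_algebra [set: X * A] <<s @open (X * A)%type >>.
  exact: smallest_sigma_algebra.
move=> _ [[B mB <-]|[B mB <-]]; rewrite setTI.
  have : <<s @open X >> B by rewrite -borelE.
  apply: (@smallest_sub _ (sigma_algebra [set: X]) _
    [set B | <<s @open (X * A)%type >> (fst @^-1` B)]).
    case: saO => s0 sC sU; split => //=.
    - by move=> C; rewrite setTD -preimage_setC => /sC; rewrite setTD.
    - by move=> F /sU; rewrite preimage_bigcup.
  move=> U oU /=; apply: sub_sigma_algebra.
  by apply: open_comp => // z _; exact: cvg_fst.
apply: sub_sigma_algebra.
by apply: open_comp => // z _; exact: cvg_snd.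
Qed.

Lemma closed_setX1 (U : set X) (B : set A) : closed U -> closed (U `*` B).
Proof.
move=> cU; rewrite (_ : U `*` B = fst @^-1` U `&` snd @^-1` B)//.
apply: closedI; apply: closed_comp => //.
- by move=> z _; exact: cvg_fst.
- by move=> z _; exact: cvg_snd.
- by rewrite -openC.
Qed.

Lemma hausdorff_prod_discrete : hausdorff_space X -> hausdorff_space (X * A)%type.
Proof.
rewrite !open_hausdorff => hX [x a] [y b] xayb.
have [ab|ab] := eqVneq a b; last first.
  exists ([set: X] `*` [set a], [set: X] `*` [set b]) => /=.
    by rewrite !inE.
  split; [exact: open_setX1 openT|exact: open_setX1 openT|].
  by apply/eqP; rewrite -subset0 => -[? ?] [[/= _ ->] [_ /= ba]]; rewrite ba eqxx in ab.
have xy : x != y by apply: contra xayb => /eqP ->; rewrite ab.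
have [[U V] /= [xU yV] [oU oV UV]] := hX _ _ xy.
exists (U `*` setT, V `*` setT) => /=.
  by rewrite !inE in xU yV *.
split; [exact: open_setX1|exact: open_setX1|].
apply/eqP; rewrite -subset0 => -[z b'] [[/= Uz _] [/= Vz _]].
by have : (U `&` V) z by []; rewrite (eqP UV).
Qed.

(** Disjoint closed sets are separated independently in each section. *)
Lemma normal_prod_discrete (R : realType) : normal_space X -> normal_space (X * A)%type.
Proof.
move=> nX; apply/(@normal_openP R) => F F' cF cF' FF'.
have /choice[U /choice[V UV]] : forall a, exists U, exists V,
    [/\ open U, open V, ysection F a `<=` U, ysection F' a `<=` V & U `&` V = set0].
  move=> a; apply: ((@normal_openP R X).1 nX).
  - exact: closed_ysection.
  - exact: closed_ysection.
  - by rewrite -ysectionI FF' ysection0.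
exists [set z | U z.2 z.1], [set z | V z.2 z.1]; split.
- by apply: open_ysections => a; rewrite ysectionE; have [] := UV a.
- by apply: open_ysections => a; rewrite ysectionE; have [] := UV a.
- by move=> [x a] Fxa; have [_ _ + _ _] := UV a; apply; rewrite ysectionE.
- by move=> [x a] Fxa; have [_ _ _ + _] := UV a; apply; rewrite ysectionE.
- rewrite -subset0 => -[x a] [/= Ux Vx]; have [_ _ _ _ UV0] := UV a.
  by have : (U a `&` V a) x by []; rewrite UV0.
Qed.

(** The projection of a compact set is compact in a discrete space. *)
Lemma compact_fin_actions (K : set (X * A)) : compact K ->
  exists s : seq A, forall z, K z -> z.2 \in s.
Proof.
move=> cK; have : compact (snd @` K).
  apply: continuous_compact => //; apply: continuous_subspaceT => z.
  exact: cvg_snd.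
rewrite compact_cover => /(_ _ setT (fun a => [set a])) [] //.
  by move=> a _; exists a.
move=> D _ KD; exists (finmap.enum_fset D) => z Kz.
by have [|a /= aD ->] := KD z.2; first by exists z.
Qed.

End countable_discrete_factor.

(** * From finitely additive contents to measures *)
Section finitely_additive.
Context d (T : measurableType d) (R : realType) (m : set T -> R).
Hypothesis m_ge0 : forall B, measurable B -> 0 <= m B.
Hypothesis mU : forall A B, measurable A -> measurable B ->
  A `&` B = set0 -> m (A `|` B) = m A + m B.

Lemma finitely_additive_le A B :
  measurable A -> measurable B -> A `<=` B -> m A <= m B.
Proof.
move=> mA mB AB; rewrite -(setDUK AB) mU//; last by rewrite setDIK.
  by rewrite lerDl; apply: m_ge0; exact: measurableD.
exact: measurableD.
Qed.

Lemma finitely_additive0 : m set0 = 0.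
Proof.
have := mU measurable0 measurable0 (setI0 _); rewrite setU0 => /eqP.
by rewrite -subr_eq0 opprD addrA subrr add0r oppr_eq0 => /eqP.
Qed.

Lemma finitely_additiveU_le A B :
  measurable A -> measurable B -> m (A `|` B) <= m A + m B.
Proof.
move=> mA mB; have -> : A `|` B = A `|` (B `\` A).
  by apply/seteqP; split=> x; have := pselect (A x); rewrite /setU/setD/=; tauto.
rewrite mU ?setDIK//; last exact: measurableD.
by rewrite lerD2l; apply: finitely_additive_le => //; exact: measurableD.
Qed.

End finitely_additive.

Section content_extension.
Context d (T : borelType d) (R : realType).
Hypothesis hausT : hausdorff_space T.
Hypothesis normT : normal_space T.
Variable m : set T -> R.
Hypothesis m_ge0 : forall B, measurable B -> 0 <= m B.
Hypothesis mU : forall A B, measurable A -> measurable B ->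
  A `&` B = set0 -> m (A `|` B) = m A + m B.

Lemma compact_borel (K : set T) : compact K -> measurable K.
Proof. by move=> cK; apply: closed_borel; exact: compact_closed. Qed.

Let m_le := finitely_additive_le m_ge0 mU.
Let m0 := finitely_additive0 mU.
Let mU_le := finitely_additiveU_le m_ge0 mU.

(** Only the compact sets are measured by the content. Since a compact set meets
    just finitely many members of an open cover, this turns finite additivity
    into countable subadditivity. *)
Definition inner_content (G : set T) : \bar R :=
  ereal_sup [set (m K)%:E | K in [set K | compact K /\ K `<=` G]].

Definition outer_content (E : set T) : \bar R :=
  ereal_inf [set inner_content G | G in [set G | open G /\ E `<=` G]].

Local Open Scope ereal_scope.

Lemma inner_content_ge0 G : 0 <= inner_content G.
Proof.
apply: ereal_sup_ubound; exists set0; last by rewrite m0.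
by split; [exact: compact0|exact: sub0set].
Qed.

Lemma compact_le_inner_content K G : compact K -> K `<=` G ->
  (m K)%:E <= inner_content G.
Proof. by move=> cK KG; apply: ereal_sup_ubound; exists K. Qed.

Lemma le_inner_content G H : G `<=` H -> inner_content G <= inner_content H.
Proof.
move=> GH; apply: ge_ereal_sup => _ [K [cK KG] <-].
by apply: compact_le_inner_content => //; exact: subset_trans GH.
Qed.

(** Normality separates the parts of a compact [K] outside [G] and outside [H],
    which splits [K] into a compact subset of [G] and one of [H]. *)
Lemma inner_contentU G H : open G -> open H ->
  inner_content (G `|` H) <= inner_content G + inner_content H.
Proof.
move=> oG oH; apply: ge_ereal_sup => _ [K [cK KGH] <-].
have clK : closed K by exact: compact_closed.
have cKG : closed (K `\` G) by apply: closedI => //; exact: open_closedC.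
have cKH : closed (K `\` H) by apply: closedI => //; exact: open_closedC.
have KGH0 : (K `\` G) `&` (K `\` H) = set0.
  by rewrite -subset0 => x [[Kx nGx] [_ nHx]]; have [] := KGH _ Kx.
have [U [V [oU oV KU KV UV]]] := (normal_openP (R := R)).1 normT _ _ cKG cKH KGH0.
have cKDU : compact (K `\` U).
  by apply: subclosed_compact cK _ => //; apply: closedI => //; exact: open_closedC.
have cKDV : compact (K `\` V).
  by apply: subclosed_compact cK _ => //; apply: closedI => //; exact: open_closedC.
apply: (@le_trans _ _ (m (K `\` U) + m (K `\` V))%:E).
  rewrite lee_fin; apply: le_trans (mU_le _ _); [|exact: compact_borel..].
  apply: m_le; [exact: compact_borel|apply: measurableU; exact: compact_borel|].
  move=> x Kx; have [Ux|nUx] := pselect (U x); [right|by left].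
  by split=> // Vx; have : (U `&` V) x by []; rewrite UV.
rewrite EFinD; apply: leeD; apply: compact_le_inner_content => // x [Kx nx].
  by apply: contrapT => nGx; apply: nx; exact: KU.
by apply: contrapT => nGx; apply: nx; exact: KV.
Qed.

(** A compact subset of the union lies in a finite subunion. *)
Lemma inner_content_bigcup (G : (set T)^nat) : (forall n, open (G n)) ->
  inner_content (\bigcup_n G n) <= \sum_(n <oo) inner_content (G n).
Proof.
move=> oG; apply: ge_ereal_sup => _ [K [cK KG] <-].
have [n KGn] : exists n, K `<=` \big[setU/set0]_(i < n) G i.
  move: (cK); rewrite compact_cover => /(_ _ setT G) [] // D _ KD.
  exists (\max_(i <- finmap.enum_fset D) i).+1 => x /KD [i /= iD Gix].
  rewrite -bigcup_mkord; exists i => //=.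
  by rewrite ltnS; apply: leq_bigmax_seq.
apply: (@le_trans _ _ (\sum_(0 <= i < n) inner_content (G i))); last first.
  by apply: nneseries_lim_ge => i _ _; exact: inner_content_ge0.
apply: (le_trans (compact_le_inner_content cK KGn)) => {KGn}.
elim: n => [|n ih].
  rewrite big_ord0 big_geq//; apply: ge_ereal_sup => _ [K' [_ K'0] <-].
  by rewrite (_ : K' = set0) ?m0//; apply/seteqP; split.
rewrite big_ord_recr big_nat_recr//=.
apply: le_trans (inner_contentU _ _) _ => //.
  by rewrite -bigcup_mkord; exact: bigcup_open.
exact: leeD2r.
Qed.

Lemma outer_content_ge0 E : 0 <= outer_content E.
Proof.
by apply: le_ereal_inf_tmp => _ [G _ <-]; exact: inner_content_ge0.
Qed.

Lemma outer_content_open G : open G -> outer_content G = inner_content G.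
Proof.
move=> oG; apply/eqP; rewrite eq_le; apply/andP; split.
  by apply: ereal_inf_lbound; exists G => //; split.
by apply: le_ereal_inf_tmp => _ [H [oH GH] <-]; exact: le_inner_content.
Qed.

Lemma outer_content0 : outer_content set0 = 0.
Proof.
rewrite outer_content_open; last exact: open0.
apply/eqP; rewrite eq_le inner_content_ge0 andbT.
apply: ge_ereal_sup => _ [K' [_ K'0] <-].
by rewrite (_ : K' = set0) ?m0//; apply/seteqP; split.
Qed.

Lemma le_outer_content E F : E `<=` F -> outer_content E <= outer_content F.
Proof.
move=> EF; apply: le_ereal_inf_tmp => _ [G [oG FG] <-].
by apply: ereal_inf_lbound; exists G => //; split=> //; exact: subset_trans FG.
Qed.

(** Tightness: the mass that escapes from the compact sets would be lost in
    [outer_content]. *)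
Hypothesis tightm : forall e : R, (0 < e)%R -> exists2 K, compact K & (m (~` K) <= e)%R.

Lemma outer_content_fin E : outer_content E \is a fin_num.
Proof.
rewrite ge0_fin_numE ?outer_content_ge0//.
apply: (@le_lt_trans _ _ (outer_content setT)); first exact: le_outer_content.
rewrite outer_content_open; last exact: openT.
apply: (@le_lt_trans _ _ (m setT)%:E); last exact: ltry.
apply: ge_ereal_sup => _ [K [cK _] <-]; rewrite lee_fin; apply: m_le => //.
exact: compact_borel.
Qed.

Lemma outer_content_approx E (e : R) : (0 < e)%R ->
  exists G, [/\ open G, E `<=` G & inner_content G <= outer_content E + e%:E].
Proof.
move=> e0; have [_ [G [oG EG] <-] /ltW Ge] := lb_ereal_inf_adherent e0 (outer_content_fin E).
by exists G.
Qed.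

Lemma outer_content_sigma_subadditive : sigma_subadditive outer_content.
Proof.
move=> F; apply/lee_addgt0Pr => e e0.
have /choice[G GF] : forall n, exists G, [/\ open G, F n `<=` G &
    inner_content G <= outer_content (F n) + (e / (2 ^ n.+1)%:R)%:E].
  by move=> n; apply: outer_content_approx; rewrite divr_gt0.
have oG n : open (G n) by have [] := GF n.
apply: (@le_trans _ _ (\sum_(n <oo) (outer_content (F n) + (e / (2 ^ n.+1)%:R)%:E))).
  apply: (@le_trans _ _ (inner_content (\bigcup_n G n))).
    rewrite -outer_content_open; last exact: bigcup_open.
    apply: le_outer_content; apply: subset_bigcup => n _.
    by have [] := GF n.
  apply: (le_trans (inner_content_bigcup oG)).
  apply: lee_nneseries => n _; first by move=> _; exact: inner_content_ge0.
  by have [] := GF n.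
apply: le_trans (epsilon_trick _ _ _) _ => //.
- by move=> n; exact: outer_content_ge0.
- exact: ltW.
Qed.

HB.instance Definition _ := isOuterMeasure.Build R T outer_content
  outer_content0 outer_content_ge0 le_outer_content
  outer_content_sigma_subadditive.

(** Inside an open [G] of nearly the outer content of [E], take a nearly optimal
    compact [K] in [G] minus [F], then a nearly optimal compact [K'] in [G]
    minus [K], which contains the part of [E] in [F]. The content is additive on
    the disjoint sets [K] and [K'], and both lie in [G]. *)
Lemma closed_caratheodory F : closed F -> outer_content.-caratheodory F.
Proof.
move=> cF; apply: le_caratheodory_measurable => E.
apply/lee_addgt0Pr => e e0.
have e20 : (0 < e / 2)%R by rewrite divr_gt0.
have [G [oG EG Ge]] := outer_content_approx E e20.
have oGF : open (G `&` ~` F) by apply: openI => //; exact: closed_openC.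
have infin H : open H -> inner_content H \is a fin_num.
  by move=> oH; rewrite -outer_content_open// outer_content_fin.
have inn H : open H -> exists K, [/\ compact K, K `<=` H &
    inner_content H <= (m K + e / 4)%:E].
  move=> oH; have e40 : (0 < e / 4)%R by rewrite divr_gt0.
  have [_ [K [cK KH] <-] /ltW KHe] := ub_ereal_sup_adherent e40 (infin H oH).
  exists K; split=> //; move: KHe; rewrite -/(inner_content H).
  by rewrite -(fineK (infin H oH)) -EFinB !lee_fin lerBlDr.
have [K [cK KG KGe]] := inn _ oGF.
(* Each of the two compact sets is optimal up to [e / 4]. *)
have oGK : open (G `\` K)
  by apply: openI => //; apply: closed_openC; exact: compact_closed.
have [K' [cK' KG' KGe']] := inn _ oGK.
have KK' : m (K' `|` K) = (m K' + m K)%R.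
  apply: mU; [exact: compact_borel..|].
  by rewrite -subset0 => x [/KG'[_ ?]].
apply: (@le_trans _ _ (inner_content (G `\` K) + inner_content (G `&` ~` F))).
  rewrite -!outer_content_open//; apply: leeD; apply: le_outer_content.
    by move=> x [Ex Fx]; split; [exact: EG|move=> /KG[]].
  by move=> x [Ex Fx]; split=> //; exact: EG.
apply: (@le_trans _ _ ((m K' + e / 4)%:E + (m K + e / 4)%:E)); first exact: leeD.
apply: (@le_trans _ _ (inner_content G + (e / 2)%:E)).
  apply: (@le_trans _ _ ((m (K' `|` K))%:E + (e / 2)%:E)).
    by rewrite -!EFinD lee_fin KK'; lra.
  apply: leeD2r; apply: compact_le_inner_content; first exact: compactU.
  by move=> x [/KG'[]|/KG[]].
apply: (@le_trans _ _ (outer_content E + (e / 2)%:E + (e / 2)%:E)).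
  exact: leeD2r.
by rewrite -addeA -EFinD -splitr.
Qed.

Lemma borel_caratheodory : @measurable _ T `<=` outer_content.-cara.-measurable.
Proof.
rewrite borelE; apply: smallest_sub.
  split => //; [by move=> X mX; rewrite setTD; exact: measurableC |
                by move=> u_ mu_; exact: bigcupT_measurable].
move=> G oG; rewrite -(setCK G); apply: measurableC.
by apply: closed_caratheodory; exact: open_closedC.
Qed.

Definition content_measure : set T -> \bar R := outer_content.

Let cm0 : content_measure set0 = 0. Proof. exact: outer_content0. Qed.
Let cm_ge0 A : 0 <= content_measure A. Proof. exact: outer_content_ge0. Qed.
Let cm_sigma : semi_sigma_additive content_measure.
Proof.
move=> F mF tF mUF; apply: caratheodory_measure_sigma_additive => //.
  by move=> i; exact: (borel_caratheodory (mF i)).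
exact: borel_caratheodory.
Qed.

HB.instance Definition _ :=
  isMeasure.Build _ _ _ content_measure cm0 cm_ge0 cm_sigma.

(** For a closed [F] only the compact part of [F] is seen by [outer_content];
    the remaining part has small content by tightness. *)
Lemma closed_le_content_measure F : closed F -> (m F)%:E <= content_measure F.
Proof.
move=> cF; apply/lee_addgt0Pr => e e0; have [K cK Ke] := tightm e0.
rewrite -leeBlDr//; apply: le_ereal_inf_tmp => _ [G [oG FG] <-].
have cFK : compact (F `&` K) by rewrite setIC; apply: compact_closedI.
apply: (@le_trans _ _ (m (F `&` K))%:E); last first.
  by apply: compact_le_inner_content => //; apply: subset_trans FG; exact: subIsetl.
rewrite -EFinB lee_fin lerBlDr.
have mK := compact_borel cK; have mF := closed_borel cF.
rewrite -{1}(setUIDK F K); apply: (le_trans (mU_le _ _)).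
- exact: measurableI.
- exact: measurableD.
- rewrite lerD2l; apply: le_trans Ke; apply: m_le.
  + exact: measurableD.
  + exact: measurableC.
  + by move=> x [].
Qed.

Hypothesis m1 : m setT = 1%R.

Let cm1 : content_measure setT = 1.
Proof.
apply/eqP; rewrite eq_le -[X in _ && (X%:E <= _)]m1.
rewrite closed_le_content_measure ?andbT; last exact: closedT.
rewrite /content_measure outer_content_open; last exact: openT.
apply: ge_ereal_sup => _ [K [cK _] <-]; rewrite lee_fin -m1; apply: m_le => //.
exact: compact_borel.
Qed.

HB.instance Definition _ :=
  Measure_isProbability.Build _ _ _ content_measure cm1.

(** A finitely additive form of Prokhorov's theorem, together with the half of
    the portmanteau theorem that concerns closed sets. *)
Lemma content_measure_exists :
  exists g : probability T R, forall F, closed F -> (m F)%:E <= g F.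
Proof. by exists content_measure; exact: closed_le_content_measure. Qed.

End content_extension.

(** * Limits along an ultrafilter *)
Section ultrafilter_limit.
Context (R : realType) (U : set_system nat).
Hypothesis ultraU : UltraFilter U.

(** The sequence has a cluster point by compactness, and an ultrafilter converges
    to its cluster points. *)
Lemma bounded_ultra_cvg (u : nat -> R) (a b : R) :
  (forall n, a <= u n <= b) -> u n @[n --> U] --> lim (u n @[n --> U]).
Proof.
move=> uab; have PU : ProperFilter (u n @[n --> U]) by exact: fmap_proper_filter.
have Uab : (u n @[n --> U]) `[a, b]%classic.
  rewrite (_ : (_ @ _) _ = U (u @^-1` `[a, b]%classic))//.
  rewrite (_ : _ @^-1` _ = setT); first exact: filterT.
  by apply/seteqP; split=> // n _ /=; rewrite in_itv/=.
have [l [_ lcl]] := @segment_compact R a b _ PU Uab.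
have ul : u n @[n --> U] --> l.
  move=> B nB; have [//|UC] := in_ultra_setVsetC (u @^-1` B) ultraU.
  have UC' : (u n @[n --> U]) (~` B) by [].
  by have [x []] := lcl _ _ UC' nB.
by apply: cvgP ul.
Qed.

End ultrafilter_limit.

Section layer_cake.
Context d (T : measurableType d) (R : realType).

(** The sum over the thresholds [1, ..., N] is the integer part of [y], capped
    at [N]; it differs from [y] by at most [1] while [y <= N]. *)
Lemma sum_thresholds_le (y : R) N : 0 <= y ->
  \sum_(i < N) (i.+1%:R <= y)%R%:R <= y.
Proof.
move=> y0; elim: N => [|N ih]; first by rewrite big_ord0.
rewrite big_ord_recr/=; case: (leP (N.+1%:R) y) => [Ny|_]; last by rewrite addr0.
apply: le_trans Ny; rewrite -natr1 lerD2r.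
apply: (@le_trans _ _ (\sum_(i < N) (1 : R))); last first.
  by rewrite sumr_const card_ord.
by apply: ler_sum => i _; case: (i.+1%:R <= y)%R; rewrite ?ler01.
Qed.

Lemma le_sum_thresholds (y : R) N : y <= N%:R ->
  y <= 1 + \sum_(i < N) (i.+1%:R <= y)%R%:R.
Proof.
elim: N => [|N ih] yN; first by rewrite big_ord0 addr0 (le_trans yN).
rewrite big_ord_recr/= addrA; have [yN'|Ny] := leP y N%:R.
  by rewrite (le_trans (ih yN'))// lerDl.
apply: (le_trans yN); rewrite (eq_bigr (fun=> 1)).
  by rewrite sumr_const card_ord -natr1 [N%:R + 1]addrC lerDl.
by move=> i _; rewrite (le_trans _ (ltW Ny))// ler_nat.
Qed.

Lemma measurable_superlevel (f : T -> R) t : measurable_fun [set: T] f ->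
  measurable [set z | t <= f z].
Proof.
move=> mf; have := mf measurableT `[t, +oo[%classic (measurable_itv _).
rewrite setTI; congr measurable; apply/seteqP.
by split=> z; rewrite /= in_itv/= andbT.
Qed.

Local Open Scope ereal_scope.

Lemma integral1_probability (P : probability T R) : \int[P]_z 1 = 1.
Proof. by rewrite integral_cst// mul1e; exact: probability_setT. Qed.

(** Integrate the bounds for the integer part of [N * f]. Being a finite sum over superlevel sets, it still makes sense for the
    finitely additive limits below. *)
Lemma layer_cake (P : probability T R) (f : T -> R) N :
  measurable_fun [set: T] f -> (forall z, 0 <= f z <= 1)%R ->
  \sum_(i < N) P [set z | (i.+1%:R <= N%:R * f z)%R] <=
    N%:R%:E * \int[P]_z (f z)%:E <=
  1 + \sum_(i < N) P [set z | (i.+1%:R <= N%:R * f z)%R].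
Proof.
move=> mf f01; set S := \sum_(i < N) _.
have mE (i : 'I_N) : measurable [set z | (i.+1%:R <= N%:R * f z)%R].
  by apply: measurable_superlevel; exact: measurable_funM.
pose g i z : \bar R := (\1_[set z | (i.+1%:R <= N%:R * f z)%R] z)%:E.
have mg (i : 'I_N) : measurable_fun [set: T] (g i).
  by apply/measurable_EFinP; exact: measurable_indic.
have ESE : S = \int[P]_z \sum_(i < N) g i z.
  rewrite /S ge0_integral_sum//; last by move=> i z _; rewrite lee_fin.
apply: eq_bigr => i _.
  by rewrite integral_indic// setIT.
have gE z : \sum_(i < N) g i z =
    (\sum_(i < N) (i.+1%:R <= N%:R * f z)%R%:R)%:E.
  rewrite -sumEFin; apply: eq_bigr => i _; rewrite /g indicE; congr ((nat_of_bool _)%:R%:E).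
  by apply/idP/idP; rewrite inE.
have mS : measurable_fun [set: T] (fun z => \sum_(i < N) g i z).
  exact: emeasurable_sum.
have mfE : measurable_fun [set: T] (fun z => (f z)%:E) by exact/measurable_EFinP.
have f0 z : 0 <= (f z)%:E by rewrite lee_fin; case/andP: (f01 z).
have g0 z : 0 <= \sum_(i < N) g i z.
  by apply: sume_ge0 => i _; rewrite lee_fin.
rewrite -ge0_integralZl//.
have mNfE : measurable_fun [set: T] (fun z => N%:R%:E * (f z)%:E).
  exact: measurable_funeM.
apply/andP; split.
  rewrite ESE; apply: ge0_le_integral => //.
  move=> z _; rewrite gE -EFinM lee_fin; apply: sum_thresholds_le.
  by rewrite mulr_ge0//; case/andP: (f01 z).
have -> : 1 + S = \int[P]_z (1 + \sum_(i < N) g i z).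
  by rewrite ge0_integralD// ESE integral1_probability.
apply: ge0_le_integral => //.
- by move=> z _; rewrite mule_ge0// lee_fin.
- by apply: emeasurable_funD.
move=> z _; rewrite gE -EFinM -EFinD lee_fin; apply: le_sum_thresholds.
by rewrite ler_piMr//; case/andP: (f01 z).
Qed.

End layer_cake.

Section finitely_additive_limit.
Context d (T : measurableType d) (R : realType) (U : set_system nat).
Hypothesis ultraU : UltraFilter U.
Variable gam : nat -> probability T R.

Definition limit_content (B : set T) : R := lim (fine (gam n B) @[n --> U]).

Lemma limit_content_cvg B : measurable B ->
  fine (gam n B) @[n --> U] --> limit_content B.
Proof.
move=> mB; apply: (bounded_ultra_cvg ultraU (a := 0) (b := 1)) => n.
rewrite fine_ge0//= -lee_fin fineK ?fin_num_measure//.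
exact: probability_le1.
Qed.

Lemma limit_content_unique B l : fine (gam n B) @[n --> U] --> l ->
  limit_content B = l.
Proof. by move=> h; apply: cvg_lim => //. Qed.

Lemma limit_content_ge0 B : measurable B -> 0 <= limit_content B.
Proof.
move=> mB; apply: (ler_cvg_to (cvg_cst 0) (limit_content_cvg mB)).
by apply: filterE => n; exact: fine_ge0.
Qed.

Lemma limit_contentU A B : measurable A -> measurable B -> A `&` B = set0 ->
  limit_content (A `|` B) = limit_content A + limit_content B.
Proof.
move=> mA mB AB; apply: limit_content_unique.
rewrite (_ : (fun n => _) = fun n => fine (gam n A) + fine (gam n B)).
  by apply: cvgD; exact: limit_content_cvg.
by apply/funext => n; rewrite measureU// fineD// fin_num_measure.
Qed.

Lemma limit_contentT : limit_content [set: T] = 1.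
Proof.
apply: limit_content_unique; under eq_fun do rewrite probability_setT.
exact: cvg_cst.
Qed.

Lemma limit_content_le_near B (u : nat -> R) (l : R) : measurable B ->
  (\forall n \near U, fine (gam n B) <= u n) -> u n @[n --> U] --> l ->
  limit_content B <= l.
Proof. by move=> mB ? ul; apply: ler_cvg_to (limit_content_cvg mB) ul _. Qed.

(** By [layer_cake] at level [N], comparing the measures of the superlevel sets
    compares the integrals of [N * f] up to [1]. Divide by [N]. *)
Lemma limit_integral_le (g : probability T R) (f : T -> R) (l : R) :
  measurable_fun [set: T] f -> (forall z, 0 <= f z <= 1) ->
  (forall t, 0 < t ->
    ((limit_content [set z | t <= f z])%:E <= g [set z | t <= f z]%R)%E) ->
  fine (\int[gam n]_z (f z)%:E) @[n --> U] --> l ->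
  (l%:E <= \int[g]_z (f z)%:E)%E.
Proof.
move=> mf f01 fg fl.
have intfin (P : probability T R) : (\int[P]_z (f z)%:E)%E \is a fin_num.
  rewrite ge0_fin_numE; last first.
    by apply: integral_ge0 => z _; rewrite lee_fin; case/andP: (f01 z).
  apply: (@le_lt_trans _ _ (\int[P]_z 1)%E).
    apply: ge0_le_integral => //.
    - by move=> z _; rewrite lee_fin; case/andP: (f01 z).
    - exact/measurable_EFinP.
    - by move=> z _; rewrite lee_fin; case/andP: (f01 z).
  by rewrite integral1_probability ltry.
pose E N (i : nat) := [set z | (i.+1%:R <= N%:R * f z)%R].
have mE N i : measurable (E N i).
  by apply: measurable_superlevel; exact: measurable_funM.
have key N : (0 < N)%N -> N%:R * l <= 1 + N%:R * fine (\int[g]_z (f z)%:E)%E.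
  move=> N0.
  have cS : (1 + \sum_(i < N) fine (gam n (E N i))) @[n --> U] -->
      1 + \sum_(i < N) limit_content (E N i).
    apply: cvgD; first exact: cvg_cst.
    suff: forall k (F : nat -> set T), (forall i, measurable (F i)) ->
        \sum_(i < k) fine (gam n (F i)) @[n --> U] -->
        \sum_(i < k) limit_content (F i) by apply; exact: mE.
    move=> k F mF; elim: k => [|k ih].
      by rewrite big_ord0; under eq_fun do rewrite big_ord0; exact: cvg_cst.
    rewrite big_ord_recr/=; under eq_fun do rewrite big_ord_recr/=.
    by apply: cvgD => //; exact: limit_content_cvg.
  have cN : (N%:R * fine (\int[gam n]_z (f z)%:E)%E) @[n --> U] --> N%:R * l.
    by apply: cvgM => //; exact: cvg_cst.
  apply: (@le_trans _ _ (1 + \sum_(i < N) limit_content (E N i))).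
    apply: (ler_cvg_to cN cS); apply: filterE => n.
    have /andP[_] := layer_cake (gam n) N mf f01.
    rewrite -lee_fin EFinM EFinD fineK// -sumEFin; congr (_ <= _ + _)%E.
    by apply: eq_bigr => i _; rewrite fineK ?fin_num_measure//; exact: mE.
  rewrite lerD2l.
  have /andP[+ _] := layer_cake g N mf f01.
  rewrite -(fineK (intfin g)) -EFinM => h; rewrite -lee_fin; apply: le_trans h.
  rewrite -sumEFin; apply: lee_sum => i _; rewrite -/(E N i).
  have -> : E N i = [set z | (i.+1%:R / N%:R <= f z)%R].
    by apply/seteqP; split=> z /=; rewrite ler_pdivrMr ?ltr0n// mulrC.
  by apply: fg; rewrite divr_gt0// ltr0n.
rewrite -(fineK (intfin g)) lee_fin; apply/ler_addgt0Pr => e e0.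
have [N _ /(_ N (leqnn N)) Ne] := near_infty_natSinv_lt (PosNum e0).
have := key N.+1 isT; rewrite -ler_pdivlMl// mulrDr mulKf// mulr1 addrC.
move/le_trans; apply; rewrite lerD2l; exact: ltW.
Qed.

End finitely_additive_limit.

(** * Comparison on sets closed over closed pieces *)
Section majorized_pieces.
Context (dX dA : measure_display) (X : borelType dX) (A : borelType dA).
Context (R : realType).
Hypothesis countA : countable [set: A].
Hypothesis discA : forall B : set A, open B.
Hypothesis hausX : hausdorff_space X.
Hypothesis GdeltaX : closed_Gdelta X.
Variable m : set (X * A) -> R.
Hypothesis m_ge0 : forall B, measurable B -> 0 <= m B.
Hypothesis mU : forall B C, measurable B -> measurable C ->
  B `&` C = set0 -> m (B `|` C) = m B + m C.
Variable g : {finite_measure set (X * A)%type -> \bar R}.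
Hypothesis mg : forall F, closed F -> ((m F)%:E <= g F)%E.

Let m_le := finitely_additive_le m_ge0 mU.
Let mU_le := finitely_additiveU_le m_ge0 mU.

Let measurable_closed (F : set (X * A)) : closed F -> measurable F.
Proof.
move=> cF; apply: measurable_ysections => // a; apply: closed_borel.
exact: closed_ysection.
Qed.

Let measurable_cylinder (B : set X) (C : set A) : measurable B -> measurable (B `*` C).
Proof. by move=> mB; apply: measurableX => //; exact: discrete_measurable. Qed.

(** The domination by [nu] allows one to exhaust [B] up to [e] by a closed set
    not only for measures but for the finitely additive [m] as well. *)
Lemma majorized_fibre_le (C : set X) (nu : {finite_measure set X -> \bar R}) a :
  (forall B, measurable B -> B `<=` C -> ((m (B `*` [set: A]))%:E <= nu B)%E) ->
  forall B, measurable B -> B `<=` C `*` [set a] -> ((m B)%:E <= g B)%E.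
Proof.
move=> mnu B mB BCa; pose Ba := ysection B a.
have mBa : measurable Ba by exact: measurable_ysection.
have BE : B = Ba `*` [set a].
  apply/seteqP; split=> [[x b] Bxb|[x b] [/= + ->]].
    by have [_ /= ba] := BCa _ Bxb; split; rewrite //= /Ba ysectionE/= -ba.
  by rewrite /Ba ysectionE.
apply/lee_addgt0Pr => e e0.
have [F [cF FBa Fe]] := closed_inner_regular GdeltaX nu mBa e0.
have mF : measurable F by exact: closed_borel.
have -> : m B = m (F `*` [set a]) + m ((Ba `\` F) `*` [set a]).
  rewrite -mU; [|exact: measurable_cylinder|apply: measurable_cylinder; exact: measurableD|].
    rewrite [in LHS]BE -[in LHS](setDUK FBa); congr m.
    by apply/seteqP; split=> -[x b]; rewrite /setX/setU/=; tauto.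
  by rewrite -subset0 => -[x b] [[/= Fx _] [[/= _ nFx] _]].
rewrite EFinD; apply: leeD.
  apply: le_trans (mg _) _; first exact: closed_setX1.
  apply: le_measure; rewrite ?inE//; first exact: measurable_cylinder.
  by rewrite BE => -[x b] [/= /FBa].
apply: le_trans Fe; apply: le_trans (mnu _ _ _).
- rewrite lee_fin; apply: m_le.
  + by apply: measurable_cylinder; exact: measurableD.
  + by apply: measurable_cylinder; exact: measurableD.
  + by move=> [x b] [].
- exact: measurableD.
- move=> x [Bax _]; have : B (x, a) by move: Bax; rewrite /Ba ysectionE.
  by move/BCa => [].
Qed.

(** Finite additivity copes with finitely many actions only. *)
Lemma majorized_le (C : set X) (nu : {finite_measure set X -> \bar R}) (s : seq A) :
  (forall B, measurable B -> B `<=` C -> ((m (B `*` [set: A]))%:E <= nu B)%E) ->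
  forall B, measurable B -> B `<=` C `*` [set` s] -> ((m B)%:E <= g B)%E.
Proof.
move=> mnu; elim: s => [|a s ih] B mB Bs.
  rewrite (_ : B = set0); first by rewrite (finitely_additive0 mU).
  by rewrite -subset0 => z /Bs[].
have mT (D : set A) : measurable ([set: X] `*` D) by exact: measurable_cylinder.
rewrite -(setUIDK B ([set: X] `*` [set a])).
have mI : measurable (B `&` [set: X] `*` [set a]) by exact: measurableI.
have mD : measurable (B `\` [set: X] `*` [set a]) by exact: measurableD.
have ID0 : B `&` [set: X] `*` [set a] `&` (B `\` [set: X] `*` [set a]) = set0.
  by rewrite -subset0 => z [[_ ?] []].
rewrite mU// measureU// EFinD; apply: leeD.
  apply: (majorized_fibre_le (C := C) (nu := nu) (a := a)) => //.
  by move=> z [/Bs[Cz _] [_ za]].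
apply: ih => // z [/Bs[Cz]]; rewrite /= inE => /orP[/eqP za|zs nz]; last by split.
by case; split.
Qed.

(** Up to the small content of the complement of [K j], the set [E] splits into
    its part over [D j], which is closed, and its part off [D j], where [m] is
    dominated by a finite measure and only finitely many actions occur. *)
Lemma piecewise_closed_le (K : nat -> set (X * A)) (D : nat -> set X)
    (E : set (X * A)) :
  (forall j, compact (K j)) ->
  (forall e, 0 < e -> exists j, m (~` K j) <= e) ->
  (forall j, closed (D j)) ->
  (forall j, exists nu : {finite_measure set X -> \bar R},
    forall B, measurable B -> B `<=` fst @` K j `\` D j ->
      ((m (B `*` [set: A]))%:E <= nu B)%E) ->
  measurable E -> (forall j, closed (E `&` D j `*` [set: A])) ->
  ((m E)%:E <= g E)%E.
Proof.
move=> cK tight cD maj mE cE; apply/lee_addgt0Pr => e e0.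
have [j Kj] := tight _ e0; have [nu mnu] := maj j.
have [s Ks] := compact_fin_actions discA (cK j).
have hausZ := hausdorff_prod_discrete discA hausX.
have clK : closed (K j) by exact: compact_closed.
have mK := measurable_closed clK.
have mDA : measurable (D j `*` [set: A]).
  by apply: measurable_cylinder; exact: closed_borel.
have mEK : measurable (E `&` K j) by exact: measurableI.
have mI : measurable (E `&` K j `&` (D j `*` [set: A])) by exact: measurableI.
have mD : measurable (E `&` K j `\` (D j `*` [set: A])) by exact: measurableD.
have h1 : m E <= m (E `&` K j) + e.
  rewrite -{1}(setUIDK E (K j)); apply: (le_trans (mU_le _ _)) => //.
    exact: measurableD.
  rewrite lerD2l; apply: le_trans Kj; apply: m_le.
  - exact: measurableD.
  - exact: measurableC.
  - by move=> z [].
apply: (@le_trans _ _ (m (E `&` K j) + e)%:E); first by rewrite lee_fin.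
rewrite EFinD; apply: leeD => //.
apply: (@le_trans _ _ (g (E `&` K j))); last by apply: le_measure; rewrite ?inE.
rewrite -(setUIDK (E `&` K j) (D j `*` [set: A])).
have ID0 : E `&` K j `&` D j `*` [set: A] `&` (E `&` K j `\` D j `*` [set: A]) = set0.
  by rewrite -subset0 => z [[_ ?] []].
rewrite mU// measureU// EFinD; apply: leeD.
  by apply: mg; rewrite setIAC; exact: closedI.
apply: (majorized_le (C := fst @` K j `\` D j) (nu := nu) (s := s)) => //.
move=> z [[_ Kz] nDz]; split; last exact: Ks.
by split; [exists z|move=> Dz; apply: nDz].
Qed.

End majorized_pieces.

(** * Integration against kernel products *)
Section image_probability.
Context d1 d2 (T1 : measurableType d1) (T2 : measurableType d2) (R : realType).
Variables (f : T1 -> T2) (mf : measurable_fun [set: T1] f).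

(** [distribution] for a function that comes with a proof of measurability
    instead of a structure. *)
Definition image_probability (P : probability T1 R) : probability T2 R :=
  distribution P
    (HB.pack f (isMeasurableFun.Build _ _ _ _ _ mf) : {mfun T1 >-> T2}).

Lemma image_probabilityE P B : image_probability P B = P (f @^-1` B).
Proof. by []. Qed.

Lemma ge0_integral_image_probability P (h : T2 -> \bar R) :
  measurable_fun [set: T2] h -> (forall y, 0 <= h y)%E ->
  (\int[image_probability P]_y h y = \int[P]_x h (f x))%E.
Proof. by move=> mh h0; rewrite ge0_integral_pushforward. Qed.

End image_probability.

Section kernel_product_integral.
Context d1 d2 (T1 : measurableType d1) (T2 : measurableType d2) (R : realType).
Variables (P : probability T1 R) (k : R.-pker T1 ~> T2).
Local Open Scope ereal_scope.

(** The law of the pair [(x, y)] when [y] has law [k x] and [x] is fixed. Mixing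
    it over [x] is a composition of kernels, for which the integration formula
    is known; the factor [unit] is the parameter space that such compositions
    require. *)
Definition pair_kernel (z : unit * T1) : {measure set (T1 * T2)%type -> \bar R} :=
  image_probability (pair1_measurable z.2) (pker_at k z.2).

Let measurable_pair_kernel U : measurable U ->
  measurable_fun [set: unit * T1] (pair_kernel ^~ U).
Proof.
move=> mU.
have mk : measurable_fun [set: T1] (fun x => k x (xsection U x)).
  by apply: (measurable_fun_xsection_finite_kernel k); rewrite inE.
rewrite (_ : (fun z => pair_kernel z U) = (fun x => k x (xsection U x)) \o snd).
  exact: measurableT_comp mk measurable_snd.
by apply/funext => z; rewrite /= xsectionE.
Qed.

HB.instance Definition _ :=
  isKernel.Build _ _ _ _ R pair_kernel measurable_pair_kernel.

Let pair_kernel_prob z : pair_kernel z [set: _] = 1.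
Proof. exact: probability_setT. Qed.

HB.instance Definition _ :=
  Kernel_isProbability.Build _ _ _ _ R pair_kernel pair_kernel_prob.

Lemma ge0_integral_pprod_kernel (f : T1 * T2 -> \bar R) :
  measurable_fun [set: T1 * T2] f -> (forall z, 0 <= f z) ->
  \int[pprod_kernel P k]_z f z = \int[P]_x \int[k x]_y f (x, y).
Proof.
move=> mf f0.
have mP : measurable_fun [set: unit] (fun _ : unit => P : pprobability T1 R).
  exact: measurable_cst.
have := @integral_kcomp _ _ _ _ _ _ R (kprobability mP) pair_kernel tt f f0 mf.
rewrite (_ : kcomp _ _ _ = pprod_kernel P k); last first.
  apply/funext => B; apply: eq_integral => x _.
  by rewrite xsectionE.
move=> ->; apply: eq_integral => x _.
by rewrite ge0_integral_image_probability.
Qed.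

End kernel_product_integral.

(** * Weak duality along policies *)
Section weak_duality_along_policies.
Context (R : realType) (dX dA : measure_display).
Context (X : borelType dX) (A : borelType dA) (m : mdp R X A).
Local Open Scope ereal_scope.

Lemma total_cost_ge0 n (h : hist X A n) : 0 <= total_cost m h.
Proof.
elim: n h => [|n ih] //= h; apply: adde_ge0; first exact: ih.
exact: cost_ge0.
Qed.

Lemma measurable_total_cost n :
  measurable_fun [set: hist X A n] (@total_cost _ _ _ _ _ m n).
Proof.
elim: n => [|n ih] /=; first exact: measurable_cst.
apply: emeasurable_funD.
  apply: (measurableT_comp ih).
  exact: measurableT_comp measurable_fst measurable_fst.
apply: (measurableT_comp (@cost_measurable _ _ _ _ _ m)).
exact: measurableT_comp (@measurable_hstep _ _ _ _ n) measurable_fst.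
Qed.

Lemma ge0_integral_probability_cst d (T : measurableType d) (P : probability T R)
  (r : \bar R) : \int[P]_x r = r.
Proof.
rewrite integral_cst// -[RHS]mule1; congr (_ * _); exact: probability_setT.
Qed.

Variables (rho : R) (h : X -> \bar R).
Hypothesis rho0 : (0 <= rho)%R.
Hypothesis h0 : forall x, 0 <= h x.
Hypothesis mh : measurable_fun [set: X] h.
Hypothesis rhoh : forall z, graph m z ->
  rho%:E + h z.1 <= cost m z + \int[trans m z]_y h y.

(** One stage adds [rho] on the left: by hypothesis [rho + h x_n] is at most the
    conditional expectation of the cost plus [h x_(n+1)]; off the graph this
    holds because the cost is infinite there. *)
Lemma subharmonic_total_cost pi (zeta : probability X R) n :
  (n%:R * rho)%:E + \int[zeta]_x h x <=
  \int[hist_law (m := m) pi zeta n]_z (total_cost m z + h (hstate z)).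
Proof.
have mhs k : measurable_fun [set: hist X A k] (fun z => h (hstate z)).
  exact: measurableT_comp mh (@measurable_hstate _ _ _ _ k).
have mq : measurable_fun [set: X * A] (fun z => \int[trans m z]_y h y).
  by apply: measurable_fun_integral_kernel => // U; exact: measurable_kernel.
elim: n => [|n ih] /=.
  by rewrite mul0r add0e; under [leRHS]eq_integral do rewrite add0e.
rewrite -natr1 mulrDl mul1r EFinD addeAC.
apply: (le_trans (leeD2r _ ih)).
rewrite ge0_integral_pprod_kernel; last 2 first.
- apply: emeasurable_funD; first exact: (@measurable_total_cost n.+1).
  exact: (mhs n.+1).
- by move=> z; apply: adde_ge0 => //; exact: (@total_cost_ge0 n.+1).
set P := pprod_kernel _ _.
have mc : measurable_fun [set: hist X A n * A] (fun z => cost m (hstep z)).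
  exact: measurableT_comp (@cost_measurable _ _ _ _ _ m) (@measurable_hstep _ _ _ _ n).
have mt : measurable_fun [set: hist X A n * A] (fun z => total_cost m z.1).
  exact: measurableT_comp (@measurable_total_cost n) measurable_fst.
have mqs : measurable_fun [set: hist X A n * A]
    (fun z => \int[trans m (hstep z)]_y h y).
  exact: measurableT_comp mq (@measurable_hstep _ _ _ _ n).
have mh1 : measurable_fun [set: hist X A n * A] (fun z => h (hstate z.1)).
  exact: measurableT_comp (mhs n) measurable_fst.
apply: (@le_trans _ _ (\int[P]_z (total_cost m z.1 + (rho%:E + h (hstate z.1))))).
  rewrite (eq_integral (fun z => total_cost m z.1 + h (hstate z.1) + rho%:E)); last first.
    by move=> z _; rewrite [rho%:E + _]addeC addeA.
  rewrite ge0_integralD//; last 2 first.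
  - by move=> z _; apply: adde_ge0 => //; exact: total_cost_ge0.
  - exact: emeasurable_funD.
  rewrite ge0_integral_probability_cst; apply: leeD2r.
  rewrite ge0_integral_pprod_kernel; last 2 first.
  - exact: emeasurable_funD.
  - by move=> z; apply: adde_ge0 => //; exact: total_cost_ge0.
  rewrite le_eqVlt; apply/orP; left; apply/eqP; apply: eq_integral => z _ /=.
  by rewrite (ge0_integral_probability_cst (pker_at (decision pi n) z)).
rewrite [leRHS](eq_integral (fun z =>
    total_cost m z.1 + (cost m (hstep z) + \int[trans m (hstep z)]_y h y))); last first.
  move=> z _ /=; rewrite ge0_integralD//; last first.
    by move=> y _; apply: adde_ge0; [exact: total_cost_ge0|exact: cost_ge0].
  by rewrite (ge0_integral_probability_cst (pker_at (trans m) (hstep z))) -addeA.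
apply: ge0_le_integral => //.
- move=> z _; apply: adde_ge0; first exact: total_cost_ge0.
  by apply: adde_ge0 => //; rewrite lee_fin.
- by apply: emeasurable_funD => //; exact: emeasurable_funD.
- by apply: emeasurable_funD => //; exact: emeasurable_funD.
move=> z _; apply: leeD2l; have [gz|ngz] := pselect (graph m (hstep z)).
  exact: (rhoh gz).
rewrite cost_out// addye ?leey// -ltNye (lt_le_trans (ltNyr 0))//.
exact: integral_ge0.
Qed.
End weak_duality_along_policies.

Section weak_duality.
Context (R : realType) (dX dA : measure_display).
Context (X : borelType dX) (A : borelType dA) (m : mdp R X A).
Local Open Scope ereal_scope.

Lemma average_cost_ge0 (pi : policy m) (zeta : probability X R) :
  0 <= average_cost pi zeta.
Proof.
apply: limf_esup_ge0 => // n; apply: mule_ge0; first by rewrite lee_fin.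
by apply: integral_ge0 => z _; exact: total_cost_ge0.
Qed.

Lemma dual_feasible0 : dual_feasible m (0%R, cst 0%R).
Proof.
split=> //=; first by exists 0%R => x; rewrite normr0.
by move=> z _; rewrite integral0 sube0 adde0; exact: cost_ge0.
Qed.

(** The dual constraint only involves differences of values of [h], which may
    therefore be taken nonnegative; then all integrals below are integrals of
    nonnegative functions. *)
Lemma dual_feasible_shift rho (h : X -> R) : dual_feasible m (rho, h) ->
  exists (k : X -> R) (M : R), [/\ measurable_fun [set: X] k,
    forall x, (0 <= k x <= M)%R &
    forall z, graph m z ->
      rho%:E + (k z.1)%:E <= cost m z + \int[trans m z]_y (k y)%:E].
Proof.
move=> [/= mh [M hM] H].
exists (fun x => h x + M)%R, (M + M)%R.
have hb x : (0 <= h x + M <= M + M)%R.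
  by have := hM x; rewrite ler_norml => /andP[? ?]; apply/andP; split; lra.
split=> //; first exact: measurable_funD.
move=> z gz; have := H z gz.
have mhE : measurable_fun [set: X] (EFin \o h) by exact/measurable_EFinP.
have ih : (pker_at (trans m) z).-integrable [set: X] (EFin \o h).
  apply: measurable_bounded_integrable => //.
    by rewrite -ge0_fin_numE// fin_num_measure.
  exists M; split; first exact: num_real.
  by move=> x Mx y _ /=; apply: (le_trans (hM y)); exact: ltW.
have -> : \int[trans m z]_y (h y + M)%:E = \int[trans m z]_y (h y)%:E + M%:E.
  rewrite -(ge0_integral_probability_cst (pker_at (trans m) z) M%:E).
  rewrite -(integralD measurableT ih)//.
  by apply: finite_measure_integrable_cst.
have fh : \int[trans m z]_y (h y)%:E \is a fin_num.
  exact: (integrable_fin_num measurableT ih).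
rewrite -(fineK fh) -!EFinD; case: (cost m z) (cost_ge0 m z) => [c| |]//= _.
- by rewrite -!EFinD !lee_fin => ?; lra.
- by move=> _; rewrite leey.
Qed.

(** Divide [subharmonic_total_cost] by the number of stages; the contribution of
    [h] is bounded by [M] and vanishes in the limit. *)
Lemma dual_feasible_le_average_cost rho h (pi : policy m) (zeta : probability X R) :
  dual_feasible m (rho, h) -> rho%:E <= average_cost pi zeta.
Proof.
move=> /dual_feasible_shift[k [M [mk kM H]]].
have [rho0|rho0] := leP 0%R rho; last first.
  by apply: le_trans (average_cost_ge0 pi zeta); rewrite lee_fin ltW.
have mkE : measurable_fun [set: X] (fun x => (k x)%:E) by exact/measurable_EFinP.
have k0 x : 0 <= (k x)%:E by rewrite lee_fin; case/andP: (kM x).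
have key n : rho%:E - ((n.+1)%:R^-1 * M)%:E <=
    ((n.+1)%:R^-1)%:E * \int[hist_law pi zeta n.+1]_h total_cost m h.
  have := subharmonic_total_cost rho0 k0 mkE H pi zeta n.+1.
  rewrite ge0_integralD//; last 3 first.
  - by move=> z _; exact: total_cost_ge0.
  - exact: measurable_total_cost.
  - exact: measurableT_comp mkE (@measurable_hstate _ _ _ _ n.+1).
  move=> h1.
  have h2 : \int[hist_law pi zeta n.+1]_z (k (hstate z))%:E <= M%:E.
    rewrite -[leRHS](ge0_integral_probability_cst (hist_law pi zeta n.+1)).
    apply: ge0_le_integral => //.
    - exact: measurableT_comp mkE (@measurable_hstate _ _ _ _ n.+1).
    - by move=> z _; rewrite lee_fin; case/andP: (kM (hstate z)).
  have h3 : (n.+1%:R * rho)%:E <= \int[hist_law pi zeta n.+1]_h total_cost m h + M%:E.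
    apply: le_trans (leeD2l _ h2); apply: le_trans h1.
    by rewrite leeDl//; exact: integral_ge0.
  rewrite leeBlDr// muleC.
  have -> : (n.+1%:R^-1 * M)%:E = M%:E * (n.+1%:R^-1)%:E by rewrite -EFinM mulrC.
  rewrite -ge0_muleDl; last 2 first.
  - by apply: integral_ge0 => z _; exact: total_cost_ge0.
  - by rewrite lee_fin; have /andP[] := kM point; exact: le_trans.
  have -> : rho%:E = (n.+1%:R * rho)%:E * (n.+1%:R^-1)%:E.
    by rewrite -EFinM mulrAC divff// mul1r.
  by apply: lee_wpmul2r => //; rewrite lee_fin.
rewrite /average_cost /limn_esup limf_esupE; apply: le_ereal_inf_tmp.
move=> _ [V [N _ NV] <-]; apply/lee_addgt0Pr => e e0.
have [j _ jM] : \forall j \near \oo, (j.+1%:R^-1 * M < e)%R.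
  have M0 : (0 <= M)%R by have /andP[] := kM point; exact: le_trans.
  have M1 : (0 < M + 1)%R by lra.
  have eM0 : (0 < e / (M + 1))%R by rewrite divr_gt0.
  apply: filterS (near_infty_natSinv_lt (PosNum eM0)) => j /=.
  rewrite ltr_pdivlMr// mulrDr mulr1 => /(le_lt_trans _); apply.
  by rewrite lerDl.
have {}jM := jM (maxn N j) (leq_maxr _ _).
have := key (maxn N j); rewrite leeBlDr// => /le_trans; apply.
apply: leeD; last by rewrite lee_fin ltW.
apply: ereal_sup_ubound; exists (maxn N j).+1 => //; apply: NV => /=.
exact: leq_trans (leq_maxl _ _) (leqnSn _).
Qed.

Lemma sup_dual_le_optimal_average_cost :
  sup_dual m <= optimal_average_cost m.
Proof.
apply: ge_ereal_sup => _ [[rho h] feas <-].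
apply: le_ereal_inf_tmp => _ [zeta _ <-].
apply: le_ereal_inf_tmp => _ [pi _ <-].
exact: (dual_feasible_le_average_cost pi zeta feas).
Qed.

End weak_duality.

(** * Bellman operator and occupation measures *)
Section measurable_selection.
Context (dX dA : measure_display) (X : measurableType dX) (A : measurableType dA).

(** Choose the least index [n] with [B n x]. *)
Lemma measurable_selection (e : nat -> A) (B : (set X)^nat) :
  (forall n, measurable (B n)) -> (forall x, exists n, B n x) ->
  exists2 phi : X -> A, measurable_fun [set: X] phi &
    forall x, exists2 n, phi x = e n & B n x.
Proof.
move=> mB covB.
have /choice[nu nuB] : forall x, exists n, seqDU B n x.
  move=> x; have [n Bnx] := covB x.
  have : (\bigcup_k B k) x by exists n.
  by rewrite seqDU_bigcup_eq => -[k _ ?]; exists k.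
have nuE k : nu @^-1` [set k] = seqDU B k.
  apply/seteqP; split=> [x <-//|x Bkx]; apply/eqP/negP => /negP nuk.
  have /trivIsetP/(_ _ _ I I nuk) := trivIset_seqDU B.
  by move/seteqP => [/(_ x) + _]; apply; split => //; exact: nuB.
exists (e \o nu) => [_ C mC|x]; last first.
  by exists (nu x) => //; have [] := nuB x.
rewrite setTI (_ : _ @^-1` _ = \bigcup_(k in [set k | C (e k)]) seqDU B k).
  apply: bigcup_measurable => k _; apply: measurableD => //.
  exact: bigsetU_measurable.
apply/seteqP; split=> [x Cx|x [k /= Ck]]; first by exists (nu x) => //; exact: nuB.
by rewrite -nuE => /= nux; rewrite /preimage/= nux.
Qed.

End measurable_selection.

Section bellman.
Context (R : realType) (dX dA : measure_display).
Context (X : borelType dX) (A : borelType dA) (m : mdp R X A).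
Hypothesis countA : countable [set: A].
Local Open Scope ereal_scope.

Lemma countable_enumeration : exists e : nat -> A, forall a, exists n, e n = a.
Proof.
have /countable_injP[f finj] := countA.
exists (fun n => xget point [set a | f a = n]) => a; exists (f a).
case: xgetP => [b _ /= fb|/(_ a)/=//]; apply: finj => //; exact: in_setT.
Qed.

Definition truncated_cost (N : R) (z : X * A) := mine (cost m z) N%:E.

(** Infinite off the graph, so that the infimum over all actions in [bellman]
    only sees the admissible ones. *)
Definition stage_value (N : R) (v : X -> \bar R) (z : X * A) : \bar R :=
  if z \in graph m then truncated_cost N z + \int[trans m z]_y v y else +oo.

Definition bellman (e : nat -> A) N v x : \bar R :=
  einfs (fun n => stage_value N v (x, e n)) 0%N.

(** The optimal [n]-stage cost; the truncation of the one-stage cost keeps it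
    bounded. *)
Fixpoint value (e : nat -> A) N n : X -> \bar R :=
  if n is n'.+1 then bellman e N (value e N n') else cst 0.

Lemma measurable_trans_integral (v : X -> \bar R) :
  measurable_fun [set: X] v -> (forall x, 0 <= v x) ->
  measurable_fun [set: X * A] (fun z => \int[trans m z]_y v y).
Proof.
by move=> mv v0; apply: measurable_fun_integral_kernel => // U; exact: measurable_kernel.
Qed.

Section fixed_truncation.
Variables (e : nat -> A) (N : R).
Hypothesis eA : forall a, exists n, e n = a.
Hypothesis N0 : (0 <= N)%R.

Lemma measurable_truncated_cost :
  measurable_fun [set: X * A] (truncated_cost N).
Proof.
by apply: measurable_mine; [exact: cost_measurable|exact: measurable_cst].
Qed.

Lemma truncated_cost_ge0 z : 0 <= truncated_cost N z.
Proof. by rewrite le_min cost_ge0 lee_fin. Qed.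

Section one_step.
Variable v : X -> \bar R.
Hypothesis mv : measurable_fun [set: X] v.
Hypothesis v0 : forall x, 0 <= v x.

Lemma measurable_stage_value : measurable_fun [set: X * A] (stage_value N v).
Proof.
apply: measurable_fun_ifT.
- apply: (measurable_fun_bool true); rewrite setTI.
  rewrite (_ : _ @^-1` _ = graph m); first exact: graph_measurable.
  by apply/seteqP; split=> z /=; [move/set_mem|move/mem_set].
- by apply: emeasurable_funD; [exact: measurable_truncated_cost|exact: measurable_trans_integral].
- exact: measurable_cst.
Qed.

Lemma measurable_bellman : measurable_fun [set: X] (bellman e N v).
Proof.
apply: measurable_fun_einfs => n.
exact: measurable_fun_pair1 measurable_stage_value.
Qed.

Lemma stage_value_ge0 z : 0 <= stage_value N v z.
Proof.
rewrite /stage_value; case: ifP => // _; apply: adde_ge0.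
  exact: truncated_cost_ge0.
exact: integral_ge0.
Qed.

Lemma bellman_ge0 x : 0 <= bellman e N v x.
Proof.
by apply: le_ereal_inf_tmp => _ [n _ <-]; exact: stage_value_ge0.
Qed.

Lemma bellman_le_stage x a : bellman e N v x <= stage_value N v (x, a).
Proof.
by have [n <-] := eA a; apply: ereal_inf_lbound; exists n.
Qed.

Lemma bellman_le_bound (M : R) x : (forall y, v y <= M%:E) ->
  bellman e N v x <= (N + M)%:E.
Proof.
move=> vM; have [a axa] := adm_neq0 m x.
apply: (le_trans (bellman_le_stage x a)).
rewrite /stage_value; case: ifPn => [_|]; last by rewrite notin_setE/graph.
rewrite EFinD; apply: leeD; first by rewrite ge_min lexx orbT.
rewrite -[leRHS](ge0_integral_probability_cst (pker_at (trans m) (x, a))).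
by apply: ge0_le_integral.
Qed.

(** There need not be an optimal action, but the countably many actions contain
    one that is optimal up to [eps], chosen measurably. *)
Lemma bellman_selector (M eps : R) : (forall y, v y <= M%:E) -> (0 < eps)%R ->
  exists2 phi : X -> A, measurable_fun [set: X] phi &
    forall x, graph m (x, phi x) /\
      truncated_cost N (x, phi x) + \int[trans m (x, phi x)]_y v y <=
      bellman e N v x + eps%:E.
Proof.
move=> vM e0.
have fin x : bellman e N v x \is a fin_num.
  rewrite ge0_fin_numE ?bellman_ge0//.
  exact: le_lt_trans (bellman_le_bound x vM) (ltry _).
pose B n := [set x | stage_value N v (x, e n) <= bellman e N v x + eps%:E].
have [||phi mphi phiB] := @measurable_selection _ _ X A e B.
- move=> n; rewrite -[B n]setTI; apply: emeasurable_fun_le => //.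
    exact: measurable_fun_pair1 measurable_stage_value.
  by apply: emeasurable_funD; [exact: measurable_bellman|exact: measurable_cst].
- move=> x; have [_ [n _ <-] /ltW xn] := lb_ereal_inf_adherent e0 (fin x).
  by exists n.
exists phi => // x; have [n -> ] := phiB x; rewrite /B /= {1}/stage_value.
case: ifPn => [|_]; first by rewrite inE.
by rewrite -(fineK (fin x)) -EFinD leNgt ltry.
Qed.

End one_step.

Lemma value_spec n : [/\ measurable_fun [set: X] (value e N n),
  forall x, 0 <= value e N n x & forall x, value e N n x <= (n%:R * N)%:E].
Proof.
elim: n => [|n [mv v0 vN]] /=.
  by split=> // x; rewrite mul0r.
split; [exact: measurable_bellman|exact: bellman_ge0|].
by move=> x; rewrite -natr1 mulrDl mul1r addrC; exact: bellman_le_bound.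
Qed.

Lemma value_step n z : graph m z ->
  value e N n.+1 z.1 <= cost m z + \int[trans m z]_y value e N n y.
Proof.
move=> gz; have [mv v0 _] := value_spec n.
apply: (@le_trans _ _ (stage_value N (value e N n) z)).
  by case: z gz => x a _; exact: bellman_le_stage.
rewrite /stage_value mem_set//; apply: leeD2r.
by rewrite /truncated_cost ge_min lexx.
Qed.

(** The measure [eta] counts the visits during [n] stages of nearly optimal play
    from the initial law [p], and [p'] is the law of the final state. The first
    stage contributes the law of [(x_0, a_0)]; the third clause says that the
    law of the successor of each counted state is counted again, except for [p]
    at the beginning and [p'] at the end. *)
Lemma occupation_measure (eps : R) n (p : probability X R) : (0 < eps)%R ->
  exists (eta : {measure set (X * A)%type -> \bar R}) (p' : probability X R),
  [/\ eta (~` graph m) = 0, eta [set: X * A] = n%:R%:E,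
    forall v, measurable_fun [set: X] v -> (forall x, 0 <= v x) ->
      \int[eta]_z v z.1 + \int[p']_x v x =
      \int[p]_x v x + \int[eta]_z \int[trans m z]_y v y &
    \int[eta]_z truncated_cost N z <= \int[p]_x value e N n x + (n%:R * eps)%:E].
Proof.
move=> eps0; elim: n p => [|n ih] p.
  exists mzero, p; split=> //=.
  - by move=> v mv v0; rewrite !integral_measure_zero add0e adde0.
  - by rewrite integral_measure_zero integral0 mul0r adde0.
have [mv v0 vN] := value_spec n.
have [phi mphi phiP] := bellman_selector mv v0 vN eps0.
have mpair : measurable_fun [set: X] (fun x => (x, phi x)).
  by apply: measurable_fun_pair => //; exact: measurable_id.
pose sel := image_probability mpair p.
pose p1 := image_probability measurable_snd (pprod_kernel sel (trans m)).
have intp1 v : measurable_fun [set: X] v -> (forall x, 0 <= v x) ->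
    \int[p1]_x v x = \int[sel]_z \int[trans m z]_y v y.
  move=> mv' v'0; rewrite ge0_integral_image_probability//.
  rewrite ge0_integral_pprod_kernel//.
  exact: measurableT_comp mv' measurable_snd.
have [eta [p' [eg eT ebal ec]]] := ih p1.
exists (measure_add sel eta), p'; split.
- apply: (etrans (measure_addE sel eta _)); rewrite eg adde0.
  apply: (etrans (image_probabilityE _ _ _)).
  rewrite (_ : _ @^-1` _ = set0) ?measure0//.
  by apply/seteqP; split=> // x /=; case; have [] := phiP x.
- apply: (etrans (measure_addE sel eta _)); rewrite eT.
  rewrite -natr1 addrC EFinD; congr (_ + _); exact: probability_setT.
- move=> w mw w0.
  rewrite !ge0_integral_measure_add//; last 3 first.
  + by move=> z _; exact: integral_ge0.
  + exact: measurable_trans_integral.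
  + exact: measurableT_comp mw measurable_fst.
  rewrite -addeA ebal// intp1// addeA ge0_integral_image_probability//.
    by rewrite addeA.
  exact: measurableT_comp mw measurable_fst.
rewrite ge0_integral_measure_add//; last 2 first.
- by move=> z _; exact: truncated_cost_ge0.
- exact: measurable_truncated_cost.
apply: (le_trans (leeD2l _ ec)).
rewrite intp1// addeA -natr1 mulrDl mul1r [(n%:R * eps + eps)%R]addrC EFinD.
rewrite [leRHS]addeA; apply: leeD2r.
rewrite -ge0_integralD//; last 4 first.
- by move=> z _; exact: truncated_cost_ge0.
- exact: measurable_truncated_cost.
- by move=> z _; exact: integral_ge0.
- exact: measurable_trans_integral.
have mF : measurable_fun [set: X * A]
    (fun z => truncated_cost N z + \int[trans m z]_y value e N n y).
  by apply: emeasurable_funD; [exact: measurable_truncated_cost|exact: measurable_trans_integral].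
have F0 z : 0 <= truncated_cost N z + \int[trans m z]_y value e N n y.
  by apply: adde_ge0; [exact: truncated_cost_ge0|exact: integral_ge0].
rewrite ge0_integral_image_probability//.
rewrite -[eps%:E](ge0_integral_probability_cst p).
have [mv1 v10 _] := value_spec n.+1.
rewrite -ge0_integralD//; last by move=> x _; rewrite lee_fin ltW.
apply: ge0_le_integral => //.
- exact: measurableT_comp mF mpair.
- by apply: emeasurable_funD => //; exact: measurable_cst.
- by move=> x _; have [] := phiP x.
Qed.

End fixed_truncation.
End bellman.

Section near_optimal_occupation.
Context (R : realType) (dX dA : measure_display).
Context (X : borelType dX) (A : borelType dA) (m : mdp R X A).
Local Open Scope ereal_scope.
Variable e : nat -> A.
Hypothesis eA : forall a, exists n, e n = a.

(** With [h] the average of the first [n] values, averaging the Bellman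
    inequalities [v_(k+1) x <= c + \int v_k] leaves, after telescoping, the term
    [v_n x / n], which is at least [rho]. *)
Lemma value_dual_feasible (N rho : R) n : (0 <= N)%R -> (0 < n)%N ->
  (forall x, (n%:R * rho)%:E <= value m e N n x) ->
  exists h, dual_feasible m (rho, h).
Proof.
move=> N0 n0 rhoV.
have spec k := value_spec m eA N0 k.
have Vfin k x : value m e N k x \is a fin_num.
  have [_ v0 vN] := spec k; rewrite ge0_fin_numE//.
  exact: le_lt_trans (vN x) (ltry _).
pose h x := (n%:R^-1 * \sum_(k < n) fine (value m e N k x))%R.
have hE x : (h x)%:E = n%:R^-1%:E * \sum_(k < n) value m e N k x.
  rewrite /h EFinM -sumEFin; congr (_ * _).
  by apply: eq_bigr => k _; rewrite fineK.
have mS : measurable_fun [set: X] (fun x => \sum_(k < n) value m e N k x).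
  by apply: emeasurable_sum => k; have [] := spec k.
have S0 x : 0 <= \sum_(k < n) value m e N k x.
  by apply: sume_ge0 => k _; have [_ + _] := spec k; exact.
have n0' : (0 < n%:R :> R)%R by rewrite ltr0n.
exists h; split => /=.
- apply/measurable_EFinP.
  rewrite (_ : EFin \o h = fun x => n%:R^-1%:E * \sum_(k < n) value m e N k x).
    exact: measurable_funeM.
  by apply/funext => x /=; rewrite hE.
- exists (n%:R^-1 * \sum_(k < n) (k%:R * N))%R => x.
  rewrite ger0_norm; last first.
    apply: mulr_ge0; first by rewrite invr_ge0 ltW.
    apply: sumr_ge0 => k _; apply: fine_ge0; have [_ + _] := spec k; exact.
  apply: ler_wpM2l; first by rewrite invr_ge0 ltW.
  apply: ler_sum => k _; rewrite -lee_fin fineK//; have [_ _ +] := spec k; exact.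
move=> z gz.
have cfin : cost m z \is a fin_num by rewrite ge0_fin_numE ?cost_ge0// cost_fin.
have Ifin k : \int[trans m z]_y value m e N k y \is a fin_num.
  have [mv v0 vN] := spec k; rewrite ge0_fin_numE ?integral_ge0//.
  apply: (@le_lt_trans _ _ (k%:R * N)%:E); last exact: ltry.
  rewrite -[leRHS](ge0_integral_probability_cst (pker_at (trans m) z)).
  by apply: ge0_le_integral.
have -> : \int[trans m z]_y (h y)%:E =
    (n%:R^-1 * \sum_(k < n) fine (\int[trans m z]_y value m e N k y))%:E.
  under eq_integral do rewrite hE.
  rewrite ge0_integralZl//.
  rewrite EFinM -sumEFin; congr (_ * _).
  rewrite ge0_integral_sum//.
  - by apply: eq_bigr => k _; rewrite fineK.
  - by move=> k; have [] := spec k.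
  - by move=> k x _; have [_ + _] := spec k; exact.
rewrite -(fineK cfin).
set q := (n%:R^-1 * \sum_(k < n) _)%R.
rewrite (_ : _ - _ = (rho + h z.1 - q)%:E)// lee_fin {}/q.
have step k : (fine (value m e N k.+1 z.1) <=
    fine (cost m z) + fine (\int[trans m z]_y value m e N k y))%R.
  by rewrite -lee_fin EFinD !fineK//; exact: value_step.
(* The sum of the first [k] steps, after cancellation of the common terms. *)
have tele k : (\sum_(i < k) fine (value m e N i z.1) + fine (value m e N k z.1) <=
   k%:R * fine (cost m z) + \sum_(i < k) fine (\int[trans m z]_y value m e N i y))%R.
  elim: k => [|k ih]; first by rewrite !big_ord0 mul0r !add0r /=.
  rewrite !big_ord_recr/=; have := step k => /=.
  rewrite -natr1 mulrDl mul1r; move: ih => /=; set a := bellman _ _ _ _ _; lra.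
have rhoVz : (n%:R * rho <= fine (value m e N n z.1))%R.
  by rewrite -lee_fin fineK.
have {tele} := tele n.
set S := (\sum_(i < n) fine (value m e N i z.1))%R.
set J := (\sum_(i < n) fine (\int[trans m z]_y value m e N i y))%R.
move=> tele; rewrite /h -/S.
rewrite -(ler_pM2l n0') mulrBr mulrDr !mulrA divff ?gt_eqF// !mul1r; lra.
Qed.

(** No dual feasible pair has [rho = s + 1 / n.+1], so by
    [value_dual_feasible] some state [x] has an optimal [n.+1]-stage cost below
    [n.+1 * (s + 1 / n.+1)]. Take the normalized occupation measure
    of [n.+1] stages from [x], played optimally up to [1 / n.+1]. *)
Lemma near_optimal_occupation (s : R) n : sup_dual m <= s%:E ->
  exists g : probability (X * A)%type R,
  [/\ g (~` graph m) = 0,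
    forall v : X -> R, measurable_fun [set: X] v ->
      (forall x, 0 <= v x <= 1)%R ->
      \int[g]_z (v z.1)%:E <=
        \int[g]_z \int[trans m z]_y (v y)%:E + (n.+1%:R^-1)%:E &
    \int[g]_z truncated_cost m n.+1%:R z <= (s + 2 * n.+1%:R^-1)%:E].
Proof.
move=> sups; set N : R := n.+1%:R.
have N0 : (0 <= N)%R by exact: ler0n.
have Np : (0 < N)%R by exact: ltr0n.
have NV0 : (0 <= N^-1)%R by rewrite invr_ge0.
have [x xV] : exists x, value m e N n.+1 x < (N * (s + N^-1))%:E.
  apply: contrapT => H.
  have [//|h feas] := @value_dual_feasible N (s + N^-1) n.+1 N0 (ltn0Sn n).
    by move=> x; rewrite leNgt; apply/negP => xV; apply: H; exists x.
  have : (s + N^-1)%:E <= s%:E.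
    by apply: le_trans sups; apply: ereal_sup_ubound; exists (s + N^-1, h)%R.
  by rewrite lee_fin gerDl leNgt invr_gt0 Np.
have eps0 : (0 < N^-1)%R by rewrite invr_gt0.
have [eta [p' [eg eT ebal ec]]] :=
  @occupation_measure R _ _ X A m e N eA N0 N^-1 n.+1 (dirac x) eps0.
pose g0 : {measure set (X * A)%type -> \bar R} := mscale (NngNum NV0) eta.
have g01 : g0 [set: X * A] = 1.
  apply: (etrans (y := N^-1%:E * eta setT)) => //.
  by rewrite eT -EFinM mulVf// gt_eqF.
pose g : probability (X * A)%type R :=
  HB.pack (Measure.sort g0) (Measure_isProbability.Build _ _ _ g0 g01).
have ig f : measurable_fun [set: X * A] f -> (forall z, 0 <= f z) ->
    \int[g]_z f z = N^-1%:E * \int[eta]_z f z.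
  by move=> mf f0; rewrite -(ge0_integral_mscale _ _ (NngNum NV0)).
exists g; split.
- apply: (etrans (y := N^-1%:E * eta (~` graph m))) => //.
  by rewrite eg mule0.
- move=> v mv v01.
  have mvE : measurable_fun [set: X] (fun x => (v x)%:E) by exact/measurable_EFinP.
  have v0 y : 0 <= (v y)%:E by rewrite lee_fin; case/andP: (v01 y).
  have v1 (p : probability X R) : \int[p]_x (v x)%:E <= 1.
    rewrite -[leRHS](ge0_integral_probability_cst p).
    by apply: ge0_le_integral => // y _; rewrite lee_fin; case/andP: (v01 y).
  have v0' (p : probability X R) : 0 <= \int[p]_x (v x)%:E by exact: integral_ge0.
  have mq : measurable_fun [set: X * A] (fun z => \int[trans m z]_y (v y)%:E).
    exact: measurable_trans_integral.
  have mf : measurable_fun [set: X * A] (fun z => (v z.1)%:E).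
    exact: measurableT_comp mvE measurable_fst.
  rewrite !ig//; last by move=> z; exact: integral_ge0.
  have scale a b : 0 <= b -> a <= b + 1 -> N^-1%:E * a <= N^-1%:E * b + N^-1%:E.
    move=> b0 ab; rewrite -[X in _ + X]mule1 -ge0_muleDr//.
    by apply: lee_wpmul2l => //; rewrite lee_fin.
  have bal := ebal _ mvE v0; apply: scale.
    by apply: integral_ge0 => z _; exact: integral_ge0.
  apply: (@le_trans _ _ (\int[eta]_z (v z.1)%:E + \int[p']_x (v x)%:E)).
    by rewrite leeDl.
  by rewrite bal addeC; apply: leeD2l.
rewrite ig; last 2 first.
- exact: measurable_truncated_cost.
- by move=> z; exact: truncated_cost_ge0.
have [mV V0 _] := value_spec m eA N0 n.+1.
have {}ec : \int[eta]_z truncated_cost m N z <= (N * (s + N^-1) + N * N^-1)%:E.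
  apply: (le_trans ec); rewrite EFinD; apply: leeD2r.
  by rewrite integral_dirac// diracT mul1e ltW.
apply: (@le_trans _ _ (N^-1%:E * (N * (s + N^-1) + N * N^-1)%:E)).
  by apply: lee_wpmul2l => //; rewrite lee_fin.
by rewrite -EFinM lee_fin -mulrDr mulKf ?gt_eqF// -addrA -mulr2n mulr_natl.
Qed.

End near_optimal_occupation.

(** * Disintegration and stationary policies *)
Section cylinder_measure.
Context d1 d2 (T1 : measurableType d1) (T2 : measurableType d2) (R : realType).
Variables (g : probability (T1 * T2)%type R) (C : set T2).
Hypothesis mC : measurable C.
Local Open Scope ereal_scope.

(** The measurability proof is an argument so that the measure structure can be
    inferred from the term. *)
Definition cylinder_measure (_ : measurable C) (B : set T1) : \bar R := g (B `*` C).

Let cyl0 : cylinder_measure mC set0 = 0.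
Proof. by rewrite /cylinder_measure set0X measure0. Qed.

Let cyl_ge0 B : 0 <= cylinder_measure mC B.
Proof. exact: measure_ge0. Qed.

Let cyl_sigma : semi_sigma_additive (cylinder_measure mC).
Proof.
move=> F mF tF mUF; rewrite /cylinder_measure.
rewrite (_ : \bigcup_n F n `*` C = \bigcup_n (F n `*` C)); last first.
  apply/seteqP; split=> [z [[n _ Fz] Cz]|z [n _ [Fz Cz]]]; first by exists n.
  by split=> //; exists n.
apply: measure_semi_sigma_additive.
- by move=> n; exact: measurableX.
- apply/trivIsetP => i j _ _ ij; rewrite -subset0 => z [[Fi _] [Fj _]].
  by move/trivIsetP : tF => /(_ _ _ I I ij) FF; have : (F i `&` F j) z.1 by []; rewrite FF.
- by apply: bigcupT_measurable => n; exact: measurableX.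
Qed.

HB.instance Definition _ :=
  isMeasure.Build _ _ _ (cylinder_measure mC) cyl0 cyl_ge0 cyl_sigma.

Let cyl_finite : fin_num_fun (cylinder_measure mC).
Proof. by move=> B mB; apply: fin_num_measure; exact: measurableX. Qed.

HB.instance Definition _ :=
  Measure_isFinite.Build _ _ _ (cylinder_measure mC) cyl_finite.

End cylinder_measure.

Section mixture_kernel.
Context d1 d2 (T1 : measurableType d1) (T2 : measurableType d2) (R : realType).
Local Open Scope ereal_scope.
Variables (e : nat -> T2) (w : nat -> T1 -> R) (phi : T1 -> T2).
Hypothesis w_ge0 : forall n x, (0 <= w n x)%R.
Hypothesis mw : forall n, measurable_fun [set: T1] (w n).
Hypothesis mphi : measurable_fun [set: T1] phi.

Definition total_weight x : \bar R := \sum_(n <oo) (w n x)%:E.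

(** Puts mass [w n x] at [e n]. At the points [x] where the weights do not add
    up to [1], the point mass at [phi x] keeps it a probability kernel. The
    measurability proofs are arguments so that the kernel structure can be
    inferred from the term. *)
Definition mixture_kernel (_ : forall n, measurable_fun [set: T1] (w n))
    (_ : measurable_fun [set: T1] phi) x : {measure set T2 -> \bar R} :=
  if total_weight x == 1
  then mseries (fun n => mscale (NngNum (w_ge0 n x)) (dirac (e n))) 0%N
    : {measure set T2 -> \bar R}
  else dirac (phi x) : {measure set T2 -> \bar R}.

Lemma mixture_kernelE x B : total_weight x = 1 ->
  mixture_kernel mw mphi x B = \sum_(n <oo) (w n x)%:E * (\1_B (e n))%:E.
Proof.
by move=> x1; rewrite /mixture_kernel x1 eqxx.
Qed.

Lemma mixture_kernel_default x B : total_weight x != 1 ->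
  mixture_kernel mw mphi x B = (\1_B (phi x))%:E.
Proof. by move=> /negbTE x1; rewrite /mixture_kernel x1. Qed.

Lemma measurable_total_weight : measurable_fun [set: T1] total_weight.
Proof.
apply: (@ge0_emeasurable_sum _ _ R [set: T1] (fun n x => (w n x)%:E) xpredT).
  by move=> n x _ _; rewrite lee_fin.
by move=> n _; exact/measurable_EFinP.
Qed.

Lemma measurable_total_weight_eq1 :
  measurable_fun [set: T1] (fun x => total_weight x == 1).
Proof.
apply: (measurable_fun_bool true); rewrite setTI.
rewrite (_ : _ @^-1` _ = [set: T1] `&` [set x | total_weight x = 1]).
  by apply: measurable_eqe => //; exact: measurable_total_weight.
by rewrite setTI; apply/seteqP; split=> x /= /eqP.
Qed.

Let measurable_mixture_kernel U : measurable U ->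
  measurable_fun [set: T1] (mixture_kernel mw mphi ^~ U).
Proof.
move=> mU; rewrite (_ : (fun x => mixture_kernel mw mphi x U) = fun x => if total_weight x == 1
    then \sum_(n <oo) (w n x)%:E * (\1_U (e n))%:E else (\1_U (phi x))%:E); last first.
  by apply/funext => x; case: ifPn => [/eqP/mixture_kernelE->|/mixture_kernel_default->].
apply: measurable_fun_ifT; first exact: measurable_total_weight_eq1.
- apply: (@ge0_emeasurable_sum _ _ R [set: T1]
    (fun n x => (w n x)%:E * (\1_U (e n))%:E) xpredT).
    by move=> n x _ _; rewrite mule_ge0// lee_fin.
  move=> n _; apply: emeasurable_funM; last exact: measurable_cst.
  exact/measurable_EFinP.
- apply/measurable_EFinP.
  exact: (measurableT_comp (measurable_indic mU) mphi).
Qed.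

HB.instance Definition _ :=
  isKernel.Build _ _ _ _ R (mixture_kernel mw mphi) measurable_mixture_kernel.

Let mixture_kernel_prob x : mixture_kernel mw mphi x [set: T2] = 1.
Proof.
have [x1|x1] := eqVneq (total_weight x) 1; last first.
  by rewrite mixture_kernel_default// indicT.
rewrite mixture_kernelE// -[RHS]x1; apply: eq_eseriesr => n _.
by rewrite indicT mule1.
Qed.

HB.instance Definition _ :=
  Kernel_isProbability.Build _ _ _ _ R (mixture_kernel mw mphi) mixture_kernel_prob.

End mixture_kernel.

Section disintegration.
Context (R : realType) (dX dA : measure_display).
Context (X : measurableType dX) (A : borelType dA).
Hypothesis countA : countable [set: A].
Hypothesis discA : forall B : set A, open B.
Local Open Scope ereal_scope.

(** Since the actions are countable, the conditional law of the action is given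
    by one Radon-Nikodym density per action. Cut to [G], these densities sum to
    [1] almost everywhere; [phi] handles the exceptional points, so that the
    kernel is concentrated on [G] everywhere. *)
Lemma disintegration (G : set (X * A)) (phi : X -> A) (g : probability (X * A)%type R) :
  measurable G -> measurable_fun [set: X] phi -> (forall x, G (x, phi x)) ->
  g (~` G) = 0 ->
  exists k : R.-pker X ~> A, (forall x, k x (xsection G x) = 1) /\
    forall B, measurable B ->
      pprod_kernel (image_probability measurable_fst g) k B = g B.
Proof.
move=> mG mphi Gphi gG0.
have /countable_injP[f finj] := countA.
pose e n := xget point [set a | f a = n].
have eE a : e (f a) = a.
  rewrite /e; case: xgetP => [b _ /= fb|/(_ a)/=//]; apply: finj => //; exact: in_setT.
pose C n := [set a | f a = n].
have mC n : measurable (C n) by exact: discrete_measurable.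
pose mu := image_probability measurable_fst g.
pose nu n := cylinder_measure g (mC n).
(* [nu n] is the part of the state marginal on which the action [e n] is taken. *)
have numu n : nu n `<< mu.
  apply/null_content_dominatesP => B mB muB0; apply/eqP; rewrite -measure_le0.
  rewrite -muB0; apply: le_measure; rewrite ?inE.
  - exact: measurableX.
  - by rewrite -[X in measurable X]setTI; exact: measurable_fst.
  - by move=> z [].
pose adm n := [set x | G (x, e n)].
have madm n : measurable (adm n).
  rewrite (_ : adm n = ysection G (e n)); last by rewrite ysectionE.
  exact: measurable_ysection.
pose dens n := Radon_Nikodym_SigmaFinite.f (nu n) mu.
have dens_fin n x : dens n x \is a fin_num by exact: (Radon_Nikodym_SigmaFinite.f_fin_num (numu n)).
have dens_ge0 n x : 0 <= dens n x by exact: (Radon_Nikodym_SigmaFinite.f_ge0 (numu n)).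
have mdens n : measurable_fun [set: X] (dens n).
  exact: measurable_int (Radon_Nikodym_SigmaFinite.f_integrable (numu n)).
pose w n x := (fine (dens n x) * \1_(adm n) x)%R.
have w_ge0 n x : (0 <= w n x)%R by rewrite mulr_ge0// fine_ge0.
have mw n : measurable_fun [set: X] (w n).
  apply: measurable_funM; last exact: measurable_indic.
  apply/measurable_EFinP; rewrite (_ : _ \o _ = dens n)//.
  by apply/funext => x /=; rewrite fineK.
have intw n B : measurable B -> \int[mu]_(x in B) (w n x)%:E = g (B `*` C n).
  move=> mB.
  have -> : \int[mu]_(x in B) (w n x)%:E = \int[mu]_(x in B `&` adm n) dens n x.
    rewrite integral_mkcondr; apply: eq_integral => x _.
    rewrite /w EFinM fineK// patchE indicE; case: ifP => _; first by rewrite mule1.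
    by rewrite mule0.
  rewrite -(Radon_Nikodym_SigmaFinite.f_integral (numu n)); last exact: measurableI.
  rewrite /nu /cylinder_measure.
  have sub : (B `&` adm n) `*` C n `<=` B `*` C n by move=> z [[]].
  rewrite -(setDUK sub) measureU; last 3 first.
  - by apply: measurableX => //; exact: measurableI.
  - apply: measurableD; first exact: measurableX.
    by apply: measurableX => //; exact: measurableI.
  - exact: setDIK.
  rewrite [X in _ + X](_ : _ = 0) ?adde0//; apply/eqP; rewrite -measure_le0 -gG0.
  apply: le_measure; rewrite ?inE.
  - apply: measurableD; first exact: measurableX.
    by apply: measurableX => //; exact: measurableI.
  - exact: measurableC.
  - move=> [x a] [[/= Bx fan] nad] Gxa; apply: nad; split=> //; split=> //=.
    by rewrite /adm /= -fan eE.
have Cn a : C (f a) a by [].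
have sumC (D : nat -> set X) : (forall n, measurable (D n)) ->
    \sum_(n <oo) g (D n `*` C n) = g (\bigcup_n (D n `*` C n)).
  move=> mD; rewrite measure_semi_bigcup//.
  - by move=> n; exact: measurableX.
  - apply/trivIsetP => i j _ _ ij; rewrite -subset0 => z [[_ /= fi] [_ /= fj]].
    by rewrite -fi -fj eqxx in ij.
  - by apply: bigcupT_measurable => n; exact: measurableX.
have mwE n : measurable_fun [set: X] (fun x => (w n x)%:E) by exact/measurable_EFinP.
have w0 n x : 0 <= (w n x)%:E by rewrite lee_fin.
have tot1 : ae_eq mu [set: X] (cst 1) (total_weight w).
  apply: integral_ae_eq => //.
  - exact: finite_measure_integrable_cst.
  - exact: measurable_total_weight.
  move=> E _ mE; rewrite integral_cst// mul1e integral_nneseries//; last first.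
    by move=> n; exact: measurable_funTS.
  rewrite (eq_eseriesr (g := fun n => g (E `*` C n))); last by move=> n _; exact: intw.
  rewrite (sumC (fun=> E))//; apply: (etrans (image_probabilityE _ _ _)).
  congr (g _); apply/seteqP; split=> [z Ez|z [n _ []]//].
  by exists (f z.2).
pose k : R.-pker X ~> A := mixture_kernel e w_ge0 mw mphi.
have kE x B : total_weight w x = 1 ->
    k x B = \sum_(n <oo) (w n x)%:E * (\1_B (e n))%:E.
  exact: mixture_kernelE.
exists k; split.
  move=> x; have [x1|x1] := eqVneq (total_weight w x) 1; last first.
    rewrite [LHS]mixture_kernel_default// indicE mem_set//.
    by rewrite /xsection/= inE.
  rewrite kE// -[RHS]x1; apply: eq_eseriesr => n _.
  rewrite -EFinM /w -mulrA; congr (_ * _)%:E.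
  rewrite !indicE (_ : (e n \in xsection G x) = (x \in adm n)); last first.
    by apply/idP/idP; rewrite !inE /xsection/= inE.
  by case: (_ \in _); rewrite ?mulr1 ?mulr0.
move=> B mB.
have mBC n : measurable (ysection B (e n)) by exact: measurable_ysection.
rewrite /pprod_kernel (ge0_ae_eq_integral (g := fun x =>
    \sum_(n <oo) (w n x)%:E * (\1_(ysection B (e n)) x)%:E))//; first last.
- by apply: filterS tot1 => x /(_ I) /= x1 _; rewrite kE.
- by move=> x _; apply: nneseries_ge0 => n _ _; rewrite mule_ge0// lee_fin.
- apply: (@ge0_emeasurable_sum _ _ R [set: X]
    (fun n x => (w n x)%:E * (\1_(ysection B (e n)) x)%:E) xpredT).
    by move=> n x _ _; rewrite mule_ge0// lee_fin.
  move=> n _; apply: emeasurable_funM => //.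
  by apply/measurable_EFinP; exact: measurable_indic.
- by apply: (measurable_fun_xsection_finite_kernel k); rewrite inE.
rewrite integral_nneseries//; last 2 first.
- move=> n; apply: emeasurable_funM => //.
  by apply/measurable_EFinP; exact: measurable_indic.
- by move=> n x _; rewrite mule_ge0// lee_fin.
rewrite (eq_eseriesr (g := fun n => g (ysection B (e n) `*` C n))); last first.
  move=> n _; rewrite -intw// [RHS]integral_mkcond; apply: eq_integral => x _.
  rewrite patchE indicE; case: ifP => _; first by rewrite mule1.
  by rewrite mule0.
rewrite sumC//; congr (g _); apply/seteqP; split=> [[x a] [n _ [/= + fan]]|[x a] Bxa].
  by rewrite -fan eE ysectionE.
by exists (f a) => //; split=> //=; rewrite eE ysectionE.
Qed.

End disintegration.

Section stationary_policy.
Context (R : realType) (dX dA : measure_display).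
Context (X : borelType dX) (A : borelType dA) (m : mdp R X A).
Hypothesis countA : countable [set: A].
Hypothesis discA : forall B : set A, open B.
Local Open Scope ereal_scope.

Lemma measurable_admissible_selector :
  exists2 phi : X -> A, measurable_fun [set: X] phi & forall x, graph m (x, phi x).
Proof.
have [e eA] := countable_enumeration countA.
have [||phi mphi phiP] := @measurable_selection _ _ X A e (fun n => ysection (graph m) (e n)).
- by move=> n; apply: measurable_ysection; exact: graph_measurable.
- move=> x; have [a axa] := adm_neq0 m x; have [n en] := eA a.
  by exists n; rewrite ysectionE/= en.
- by exists phi => // x; have [n ->] := phiP x; rewrite ysectionE.
Qed.

Lemma feasible_probability (g : {finite_measure set (X * A)%type -> \bar R}) :
  primal_feasible m g -> exists P : probability (X * A)%type R,
    forall B, P B = g B.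
Proof.
move=> [[gG _] g1 _].
have gT : g [set: X * A] = 1.
  rewrite -(setUv (graph m)) measureU//.
  - by rewrite [X in _ + X]gG adde0.
  - exact: graph_measurable.
  - by apply: measurableC; exact: graph_measurable.
  - exact: setICr.
pose P : probability (X * A)%type R :=
  HB.pack (FiniteMeasure.sort g) (Measure_isProbability.Build _ _ _ g gT).
by exists P.
Qed.

Section stationary_law.
Variables (g : probability (X * A)%type R) (k : R.-pker X ~> A).
Hypothesis k_adm : forall x, k x (adm m x) = 1.
Let mu := image_probability measurable_fst g.
Hypothesis kg : forall B, measurable B -> pprod_kernel mu k B = g B.
Hypothesis g_inv : forall B, measurable B -> mu B = \int[g]_z trans m z B.

Definition stationary_policy : policy m :=
  @Policy _ _ _ _ _ m
    (fun n => kpullback (@measurable_hstate _ _ _ _ n) k) (fun n h => k_adm (hstate h)).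

(** If [x_n] has law [mu], then [(x_n, a_n)] has law [g]. *)
Lemma stationary_transfer n :
  (forall B, measurable B ->
     hist_law stationary_policy mu n (@hstate _ _ X A n @^-1` B) = mu B) ->
  forall F, measurable_fun [set: X * A] F -> (forall z, 0 <= F z) ->
  \int[pprod_kernel (hist_law stationary_policy mu n) (decision stationary_policy n)]_z
    F (hstep z) = \int[g]_z F z.
Proof.
move=> inv F mF F0.
have mFs : measurable_fun [set: hist X A n * A] (fun z => F (hstep z)).
  exact: measurableT_comp mF (@measurable_hstep _ _ _ _ n).
rewrite ge0_integral_pprod_kernel//=.
pose Phi x := \int[k x]_a F (x, a).
have mPhi : measurable_fun [set: X] Phi by exact: measurable_fun_integral_finite_kernel.
have Phi0 x : 0 <= Phi x by exact: integral_ge0.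
transitivity (\int[image_probability (@measurable_hstate _ _ X A n)
    (hist_law stationary_policy mu n)]_x Phi x).
  by rewrite ge0_integral_image_probability.
rewrite (eq_measure_integral mu); last by move=> B mB _; exact: inv.
rewrite -ge0_integral_pprod_kernel//.
by apply: eq_measure_integral => B mB _; exact: kg.
Qed.

(** Invariance of [g] propagates the law [mu] from [x_n] to [x_(n+1)]. *)
Lemma stationary_state_law n B : measurable B ->
  hist_law stationary_policy mu n (@hstate _ _ X A n @^-1` B) = mu B.
Proof.
elim: n B => [|n ih] B mB; first by [].
rewrite g_inv// -(stationary_transfer ih (F := fun z => trans m z B))//.
  by apply: eq_integral => z _ /=; rewrite xsectionE.
exact: measurable_kernel.
Qed.

Lemma stationary_total_cost n :
  \int[hist_law stationary_policy mu n]_h total_cost m h =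
  n%:R%:E * \int[g]_z cost m z.
Proof.
elim: n => [|n ih] /=; first by rewrite integral0 mul0e.
have c0 : 0 <= \int[g]_z cost m z by apply: integral_ge0 => z _; exact: cost_ge0.
have mc : measurable_fun [set: hist X A n * A] (fun z => cost m (hstep z)).
  exact: measurableT_comp (@cost_measurable _ _ _ _ _ m) (@measurable_hstep _ _ _ _ n).
have mt : measurable_fun [set: hist X A n * A] (fun z => total_cost m z.1).
  exact: measurableT_comp (@measurable_total_cost _ _ _ _ _ m n) measurable_fst.
rewrite ge0_integral_pprod_kernel/=; last 2 first.
- exact: (@measurable_total_cost _ _ _ _ _ m n.+1).
- exact: (@total_cost_ge0 _ _ _ _ _ m n.+1).
set P := pprod_kernel _ _.
transitivity (\int[P]_z (total_cost m z.1 + cost m (hstep z))).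
  apply: eq_integral => z _.
  exact: (ge0_integral_probability_cst (pker_at (trans m) (hstep z))).
rewrite ge0_integralD//; last 2 first.
- by move=> z _; exact: total_cost_ge0.
- by move=> z _; exact: cost_ge0.
rewrite stationary_transfer; last 3 first.
- exact: stationary_state_law.
- exact: cost_measurable.
- exact: cost_ge0.
rewrite ge0_integral_pprod_kernel//=; last by move=> z; exact: total_cost_ge0.
transitivity (\int[hist_law stationary_policy mu n]_h total_cost m h + \int[g]_z cost m z).
  congr (_ + _); apply: eq_integral => h _.
  exact: (ge0_integral_probability_cst (pker_at (decision stationary_policy n) h)).
by rewrite ih -natr1 EFinD ge0_muleDl ?mul1e// lee_fin.
Qed.

Lemma stationary_average_cost :
  average_cost stationary_policy mu <= \int[g]_z cost m z.
Proof.
have c0 : 0 <= \int[g]_z cost m z by apply: integral_ge0 => z _; exact: cost_ge0.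
rewrite /average_cost /limn_esup limf_esupE.
apply: (@le_trans _ _ (ereal_sup [set (n%:R^-1)%:E *
  \int[hist_law stationary_policy mu n]_h total_cost m h | n in [set: nat]])).
  by apply: ereal_inf_lbound; exists setT => //; exact: filterT.
apply: ge_ereal_sup => _ [[|n] _ <-]; first by rewrite invr0 mul0e.
by rewrite stationary_total_cost muleA -EFinM mulVf// mul1e.
Qed.

End stationary_law.

Lemma optimal_average_cost_le_primal (g : {finite_measure set (X * A)%type -> \bar R}) :
  primal_feasible m g -> optimal_average_cost m <= primal_value m g.
Proof.
move=> feas; have [P PE] := feasible_probability feas.
have [phi mphi phiG] := measurable_admissible_selector.
have PG : P (~` graph m) = 0 by rewrite PE; have [[]] := feas.
have [k [kG kP]] := disintegration countA discA (@graph_measurable _ _ _ _ _ m) mphi phiG PG.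
have intE F D : measurable D -> \int[g]_(z in D) F z = \int[P]_(z in D) F z.
  by move=> mD; apply: eq_measure_integral => B mB _; exact/esym/PE.
have mG := @graph_measurable _ _ _ _ _ m.
have intG F : measurable_fun [set: X * A] F -> (forall z, 0 <= F z) ->
    \int[g]_(z in graph m) F z = \int[P]_z F z.
  move=> mF F0; rewrite intE//.
  rewrite [RHS](ge0_negligible_integral (N := ~` graph m))//; last exact: measurableC.
  by rewrite setTD setCK.
have k_adm x : k x (adm m x) = 1.
  by rewrite -(kG x); congr (k x _); rewrite xsectionE.
have inv B : measurable B -> image_probability measurable_fst P B = \int[P]_z trans m z B.
  move=> mB; rewrite -intG//; last exact: measurable_kernel.
  have [_ _ <-//] := feas; apply: (etrans (image_probabilityE _ _ _)).
  exact: PE.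
apply: (@le_trans _ _ (average_cost (stationary_policy k_adm) (image_probability measurable_fst P))).
  apply: (@le_trans _ _ (ereal_inf [set average_cost pi (image_probability measurable_fst P)
      | pi in [set: policy m]])).
    by apply: ereal_inf_lbound; exists (image_probability measurable_fst P).
  by apply: ereal_inf_lbound; exists (stationary_policy k_adm).
rewrite /primal_value intG; last 2 first.
- exact: cost_measurable.
- exact: cost_ge0.
exact: stationary_average_cost.
Qed.

End stationary_policy.

(** * Limits of occupation measures *)
Section closed_pieces.
Context (R : realType) (dX dA : measure_display).
Context (X : borelType dX) (A : borelType dA) (m : mdp R X A).
Hypothesis discA : forall B : set A, open B.
Variable D : set X.
Hypothesis cD : closed D.

(** Evaluation at [v] is continuous on [prob_wc], and a set that is closed in the
    closed subspace [D `*` setT] is closed. *)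
Lemma closed_trans_integral (v : bounded_continuous X R) (t : R) :
  {within D `*` [set: A], continuous
    (fun z => pker_at (trans m) z : prob_wc X R)} ->
  closed ([set z | t <= fine (\int[trans m z]_y (sval v y)%:E)%E] `&`
    D `*` [set: A]).
Proof.
move=> cq.
have ce : continuous (fun mu : prob_wc X R => wc_eval mu v).
  move=> mu; apply: (@continuous_comp _ _ _ (fun mu : prob_wc X R => wc_eval mu)
    (fun w : {ptws bounded_continuous X R -> R} => w v)).
    exact: initial_continuous.
  exact: (@proj_continuous {classic (bounded_continuous X R)} (fun=> R) v).
have cF : {within D `*` [set: A], continuous
    (fun z => fine (\int[trans m z]_y (sval v y)%:E)%E)}.
  move=> z; apply: (@continuous_comp _ _ _
    (fun z : subspace (D `*` [set: A]) => pker_at (trans m) z : prob_wc X R)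
    (fun mu : prob_wc X R => wc_eval mu v)); [exact: cq|exact: ce].
have : closed ((fun z : subspace (D `*` [set: A]) =>
    fine (\int[trans m z]_y (sval v y)%:E)%E) @^-1` [set r | t <= r]).
  by apply: closed_comp => [z _|]; [exact: cF|exact: closed_ge].
move/closed_subspaceP => [V cV VE].
by rewrite (_ : _ `&` _ = V `&` D `*` [set: A])//; apply: closedI => //; exact: closed_setX1.
Qed.

Lemma closed_cost_le (r : R) :
  lower_semicontinuous (cost m : subspace (D `*` [set: A]) -> \bar R) ->
  closed ([set z | (cost m z <= r%:E)%E] `&` D `*` [set: A]).
Proof.
move=> /lower_semicontinuousP/(_ r)/open_closedC.
move/closed_subspaceP => [V cV VE].
rewrite (_ : _ `&` _ = V `&` D `*` [set: A]).
  by apply: closedI => //; exact: closed_setX1.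
rewrite VE; apply/seteqP; split=> z [H Dz]; split=> //; first by apply/negP; rewrite -leNgt.
by move/negP: H; rewrite -leNgt.
Qed.

End closed_pieces.

Section limit_occupation.
Context (R : realType) (dX dA : measure_display).
Context (X : borelType dX) (A : borelType dA) (m : mdp R X A).
Hypothesis metX : metrizable R X.
Hypothesis countA : countable [set: A].
Hypothesis discA : forall B : set A, open B.
Variable K : nat -> set (X * A).
Hypothesis hSU : condSU m K.
Hypothesis hM : condM m K.
Variable s : R.
Variable gam : nat -> probability (X * A)%type R.
Hypothesis gam_graph : forall n, gam n (~` graph m) = 0%E.
Hypothesis gam_bal : forall n (v : X -> R), measurable_fun [set: X] v ->
  (forall x, 0 <= v x <= 1) ->
  (\int[gam n]_z (v z.1)%:E <=
    \int[gam n]_z \int[trans m z]_y (v y)%:E + (n.+1%:R^-1)%:E)%E.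
Hypothesis gam_cost : forall n,
  (\int[gam n]_z truncated_cost m n.+1%:R z <= (s + 2 * n.+1%:R^-1)%:E)%E.
Variable U : set_system nat.
Hypothesis ultraU : UltraFilter U.
Hypothesis ooU : \oo `<=` U.

Let ultra_cvg (u : nat -> R) (l : R) : u n @[n --> \oo] --> l -> u n @[n --> U] --> l.
Proof. by move=> ul B /ul; exact: ooU. Qed.

Let cvg_inv : n.+1%:R^-1 @[n --> U] --> (0 : R).
Proof. by apply: ultra_cvg; exact: cvg_harmonic. Qed.

Let lc := limit_content U gam.

(** Markov's inequality for the truncated cost, which is at least any given
    constant off some [K j], once the truncation level is high enough. *)
Lemma limit_content_tight (e : R) : 0 < e -> exists j, lc (~` K j) <= e.
Proof.
move=> e0; have [cK _ _ SU] := hSU.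
(* The truncated cost has integral at most [s + 2] under every [gam n]. *)
pose c : R := (`|s| + 2) / e.
have c0 : 0 < c by rewrite divr_gt0// ltr_wpDl.
have [j Kj] : exists j, forall z, (~` K j) z -> (c%:E <= cost m z)%E.
  have [j _ /(_ j (leqnn j)) /ltW jc] := cvgey_gt SU c.
  exists j => z nKz; apply: (le_trans jc); apply: ereal_inf_lbound.
  by exists z.
exists j.
have hausZ := hausdorff_prod_discrete discA (let: And3 h _ _ := metrizable_separation metX in h).
have mK : measurable (~` K j).
  apply: measurableC; apply: measurable_ysections => // a; apply: closed_borel.
  by apply: closed_ysection; exact: compact_closed.
apply: (limit_content_le_near ultraU mK (u := fun=> e)); last exact: cvg_cst.
apply: ooU; have [n _ nc] : \forall n \near \oo, c <= n%:R :> R.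
  exact: nbhs_infty_ger.
exists n => // k /= nk.
have : (c%:E * gam k (~` K j) <= (`|s| + 2)%:E)%E.
  have -> : (c%:E * gam k (~` K j) = \int[gam k]_z (c%:E * (\1_(~` K j) z)%:E))%E.
    by rewrite ge0_integralZl ?integral_indic ?setIT// ?lee_fin ?ltW//;
      apply/measurable_EFinP; exact: measurable_indic.
  apply: (@le_trans _ _ (\int[gam k]_z truncated_cost m k.+1%:R z)%E).
    apply: ge0_le_integral => //.
    - by move=> z _; rewrite mule_ge0// lee_fin ltW.
    - by apply: measurable_funeM; apply/measurable_EFinP; exact: measurable_indic.
    - exact: measurable_truncated_cost.
    move=> z _; rewrite indicE; have [/set_mem nKz|_] := boolP (z \in ~` K j).
      rewrite mule1 le_min Kj//= lee_fin; apply: nc => /=.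
      exact: leq_trans nk (leqnSn _).
    by rewrite mule0; apply: truncated_cost_ge0.
  apply: (le_trans (gam_cost k)); rewrite lee_fin; apply: lerD; first exact: ler_norm.
  by rewrite ler_piMr// invf_le1// ler1n.
rewrite -(fineK (fin_num_measure (gam k) _ mK)) -EFinM lee_fin /c mulrAC.
by rewrite ler_pdivrMr// ler_pM2l// ltr_wpDl.
Qed.

(** Up to [1 / n.+1], the state marginal of [gam n] is an average of transition
    laws, and these are at most [nu] on [O] minus [D]. *)
Lemma limit_content_majorized (D : set X) (O : set X)
    (nu : {finite_measure set X -> \bar R}) :
  (forall B z, measurable B -> graph m z ->
    (trans m z ((O `\` D) `&` B) <= nu B)%E) ->
  forall B, measurable B -> B `<=` O `\` D -> ((lc (B `*` [set: A]))%:E <= nu B)%E.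
Proof.
move=> H B mB BOD.
have mBT : measurable (B `*` [set: A]) by exact: measurableX.
rewrite -(fineK (fin_num_measure nu _ mB)) lee_fin.
apply: (limit_content_le_near ultraU mBT (u := fun n => fine (nu B) + n.+1%:R^-1)).
  apply: filterE => n; rewrite -lee_fin EFinD !fineK ?fin_num_measure//.
  have m1B : measurable_fun [set: X] (\1_B : X -> R) by exact: measurable_indic.
  have v01 x : 0 <= (\1_B x : R) <= 1.
    by rewrite indicE; case: (_ \in _); rewrite ?lexx ?ler01.
  have := gam_bal n m1B v01.
  have -> : (\int[gam n]_z (\1_B z.1)%:E = gam n (B `*` [set: A]))%E.
    rewrite -[in RHS](setIT (B `*` _)) -integral_indic//.
    apply: eq_integral => z _; rewrite !indicE; congr ((nat_of_bool _)%:R%:E).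
    by apply/idP/idP => [/set_mem Bz|/set_mem[Bz _]]; apply/mem_set.
  move=> /le_trans; apply; apply: leeD2r.
  have mt : measurable_fun [set: X * A] (fun z => trans m z B) by exact: measurable_kernel.
  rewrite (eq_integral (fun z => trans m z B)); last first.
    by move=> z _; rewrite integral_indic// setIT.
  rewrite (ge0_negligible_integral (N := ~` graph m))//; last 2 first.
  - by apply: measurableC; exact: graph_measurable.
  - exact: gam_graph.
  rewrite setTD setCK.
  apply: (@le_trans _ _ (\int[gam n]_(z in graph m) nu B)%E).
    apply: ge0_le_integral => //.
    - exact: graph_measurable.
    - exact: measurable_funTS.
    - move=> z gz; have := H B z mB gz; congr (_ <= _)%E; congr (trans m z _).
      by apply/seteqP; split=> x; [case|move=> Bx; split=> //; exact: BOD].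
  rewrite integral_cst; last exact: graph_measurable.
  rewrite -[leRHS]mule1; apply: lee_wpmul2l => //; exact: probability_le1 (graph_measurable m).
rewrite -[X in _ --> X]addr0; apply: cvgD; last exact: cvg_inv.
exact: cvg_cst.
Qed.

(** The two ways in which the limit measure controls the content: on closed sets,
    and on the sets that are closed over every [D] on which the data of the
    decision process are continuous. *)
Lemma limit_measure_exists : exists g : probability (X * A)%type R,
  (forall F, closed F -> ((lc F)%:E <= g F)%E) /\
  (forall E, measurable E ->
    (forall (D : set X), closed D ->
      {within D `*` [set: A], continuous
          (fun z => pker_at (trans m) z : prob_wc X R)} ->
      lower_semicontinuous (cost m : subspace (D `*` [set: A]) -> \bar R) ->
      closed (E `&` D `*` [set: A])) ->
    ((lc E)%:E <= g E)%E).
Proof.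
have [cK _ _ _] := hSU.
have [hausX normX GdeltaX] := metrizable_separation metX.
pose Z : borelType _ := HB.pack (X * A)%type
  (isBorelMeasurable.Build _ (X * A)%type (measurable_prod_open X countA discA)).
have [||||||g gF] := @content_measure_exists _ Z R _ _ lc.
- exact: hausdorff_prod_discrete.
- exact: (@normal_prod_discrete _ _ X A discA R).
- exact: limit_content_ge0.
- exact: limit_contentU.
- move=> e /limit_content_tight[j Kj]; exists (K j) => //; exact: cK.
- exact: limit_contentT.
exists g; split=> // E mE cE.
have /choice[D HD] : forall j, exists D, [/\ closed D,
    exists nu : {finite_measure set X -> \bar R}, forall B, measurable B ->
      B `<=` fst @` K j `\` D -> ((lc (B `*` [set: A]))%:E <= nu B)%E,
    {within D `*` [set: A], continuous
          (fun z => pker_at (trans m) z : prob_wc X R)} &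
    lower_semicontinuous (cost m : subspace (D `*` [set: A]) -> \bar R)].
  move=> j; have [V [D [nu [[_ KV] cD nuB qc lsc]]]] := hM j.
  exists D; split=> //; exists nu => B mB BKD.
  apply: limit_content_majorized nuB _ mB _ => x /BKD[/KV Vx nDx]; by split.
apply: (@piecewise_closed_le _ _ X A R countA discA hausX GdeltaX lc _ _ g _ K D) => //.
- exact: limit_content_ge0.
- exact: limit_contentU.
- exact: limit_content_tight.
- by move=> j; have [] := HD j.
- by move=> j; have [] := HD j.
- by move=> j; have [? _ ? ?] := HD j; exact: cE.
Qed.

Let integral01 (P : probability (X * A)%type R) (f : X * A -> R) :
  measurable_fun [set: X * A] f -> (forall z, 0 <= f z <= 1) ->
  0 <= fine (\int[P]_z (f z)%:E)%E <= 1 /\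
  ((\int[P]_z (f z)%:E)%E \is a fin_num /\
   (\int[P]_z (f z)%:E + \int[P]_z (1 - f z)%:E = 1)%E).
Proof.
move=> mf f01.
have mfE : measurable_fun [set: X * A] (fun z => (f z)%:E) by exact/measurable_EFinP.
have f0 z : (0 <= (f z)%:E)%E by rewrite lee_fin; case/andP: (f01 z).
have f1 : (\int[P]_z (f z)%:E <= 1)%E.
  rewrite -[leRHS](integral1_probability P); apply: ge0_le_integral => //.
  by move=> z _; rewrite lee_fin; case/andP: (f01 z).
have i0 : (0 <= \int[P]_z (f z)%:E)%E by exact: integral_ge0.
have fin : (\int[P]_z (f z)%:E)%E \is a fin_num.
  by rewrite ge0_fin_numE// (le_lt_trans f1)// ltry.
split; first by rewrite fine_ge0//= -lee_fin fineK.
split=> //; rewrite -ge0_integralD//; last 2 first.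
- by move=> z _; rewrite lee_fin subr_ge0; case/andP: (f01 z).
- by apply/measurable_EFinP; exact: measurable_funB.
rewrite -[RHS](integral1_probability P); apply: eq_integral => z _.
by rewrite -EFinD addrC subrK.
Qed.

Section limit_measure.
Variable g : probability (X * A)%type R.
Hypothesis gF : forall F, closed F -> ((lc F)%:E <= g F)%E.
Hypothesis gE : forall E, measurable E ->
  (forall (D : set X), closed D ->
    {within D `*` [set: A], continuous
        (fun z => pker_at (trans m) z : prob_wc X R)} ->
    lower_semicontinuous (cost m : subspace (D `*` [set: A]) -> \bar R) ->
    closed (E `&` D `*` [set: A])) ->
  ((lc E)%:E <= g E)%E.

Lemma limit_measure_graph : g (graph m) = 1%E.
Proof.
have [cK _ graphK _] := hSU; have [hausX _ _] := metrizable_separation metX.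
have hausZ := hausdorff_prod_discrete discA hausX.
apply/eqP; rewrite eq_le; apply/andP; split.
  by apply: probability_le1; exact: graph_measurable.
apply/lee_addgt0Pr => e e0; have [j Kj] := limit_content_tight e0.
have clK : closed (K j) by exact: compact_closed.
have mK : measurable (K j).
  apply: measurable_ysections => // a; apply: closed_borel.
  exact: closed_ysection.
have : lc (K j) + lc (~` K j) = 1.
  rewrite -limit_contentU ?setICr//; last exact: measurableC.
  by rewrite setUv; exact: limit_contentT.
move=> Kj1; apply: (@le_trans _ _ ((lc (K j))%:E + e%:E)%E).
  by rewrite -EFinD lee_fin; lra.
apply: leeD2r; apply: (le_trans (gF clK)).
apply: le_measure; rewrite ?inE//; first exact: graph_measurable.
by rewrite -graphK; exact: bigcup_sup.
Qed.

(** Both [1 - v] and [z |-> \int[trans m z]_y v y] have superlevel sets on which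
    the limit content is at most [g]. Under [gam n] their integrals add up to at
    least [1 - 1 / n.+1], hence under [g] to at least [1]. *)
Lemma limit_measure_test (v : X -> R) : continuous v ->
  (forall x, 0 <= v x <= 1) ->
  (\int[g]_z (v z.1)%:E <= \int[g]_z \int[trans m z]_y (v y)%:E)%E.
Proof.
move=> cv v01.
have mv := continuous_borel cv.
have mvE : measurable_fun [set: X] (fun x => (v x)%:E) by exact/measurable_EFinP.
have v0 x : (0 <= (v x)%:E)%E by rewrite lee_fin; case/andP: (v01 x).
have vbc : continuous v /\ exists M : R, forall x, `|v x| <= M.
  by split=> //; exists 1 => x; have /andP[? ?] := v01 x; rewrite ger0_norm.
pose vb : bounded_continuous X R := exist _ v vbc.
pose f1 (z : X * A) := 1 - v z.1.
pose f2 (z : X * A) := fine (\int[trans m z]_y (v y)%:E)%E.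
have mf1 : measurable_fun [set: X * A] f1.
  by apply: measurable_funB => //; exact: (measurableT_comp mv measurable_fst).
have f101 z : 0 <= f1 z <= 1 by have /andP[? ?] := v01 z.1; rewrite /f1; lra.
have int01 z : (0 <= \int[trans m z]_y (v y)%:E <= 1)%E.
  apply/andP; split; first exact: integral_ge0.
  rewrite -[leRHS](integral1_probability (pker_at (trans m) z)).
  by apply: ge0_le_integral => // x _; rewrite lee_fin; case/andP: (v01 x).
have f2E z : ((f2 z)%:E = \int[trans m z]_y (v y)%:E)%E.
  have /andP[i0 i1] := int01 z.
  by rewrite fineK// ge0_fin_numE// (le_lt_trans i1)// ltry.
have f201 z : 0 <= f2 z <= 1 by rewrite -!lee_fin f2E.
have mf2 : measurable_fun [set: X * A] f2.
  apply/measurable_EFinP.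
  rewrite (_ : _ \o _ = fun z => \int[trans m z]_y (v y)%:E)%E.
    exact: measurable_trans_integral.
  by apply/funext => z /=; rewrite f2E.
pose l1 : R := lim (fine (\int[gam n]_z (f1 z)%:E)%E @[n --> U]).
pose l2 : R := lim (fine (\int[gam n]_z (f2 z)%:E)%E @[n --> U]).
have c1 : fine (\int[gam n]_z (f1 z)%:E)%E @[n --> U] --> l1.
  apply: (bounded_ultra_cvg ultraU (a := 0) (b := 1)) => n.
  by have [] := integral01 (gam n) mf1 f101.
have c2 : fine (\int[gam n]_z (f2 z)%:E)%E @[n --> U] --> l2.
  apply: (bounded_ultra_cvg ultraU (a := 0) (b := 1)) => n.
  by have [] := integral01 (gam n) mf2 f201.
have i1 : (l1%:E <= \int[g]_z (f1 z)%:E)%E.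
  apply: (limit_integral_le ultraU mf1 f101) c1 => t _.
  apply: gF; apply: (closed_comp (f := f1) (D := [set r | t <= r])).
    move=> z _; apply: cvgB; first exact: cvg_cst.
    by apply: (continuous_comp (f := fst) (g := v)); [exact: cvg_fst|exact: cv].
  exact: closed_ge.
have i2 : (l2%:E <= \int[g]_z (f2 z)%:E)%E.
  apply: (limit_integral_le ultraU mf2 f201) c2 => t _.
  apply: gE; first exact: measurable_superlevel.
  move=> D cD qc _.
  exact: (@closed_trans_integral _ _ _ X A m discA D cD vb t qc).
have l12 : 1 <= l1 + l2.
  have c12 : fine (\int[gam n]_z (f1 z)%:E)%E + fine (\int[gam n]_z (f2 z)%:E)%E
      + n.+1%:R^-1 @[n --> U] --> l1 + l2 + 0.
    exact: (cvgD (cvgD c1 c2) cvg_inv).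
  rewrite -(addr0 (l1 + l2)).
  apply: (ler_cvg_to (cvg_cst (1 : R)) c12); apply: filterE => n.
  have [_ [fin1 sum1]] := integral01 (gam n) mf1 f101.
  have [_ [fin2 _]] := integral01 (gam n) mf2 f201.
  rewrite -lee_fin !EFinD !fineK// -sum1 -addeA; apply: leeD2l.
  have := gam_bal n mv v01.
  congr (_ <= _ + _)%E; first by apply: eq_integral => z _; rewrite /f1 subKr.
  by apply: eq_integral => z _; rewrite f2E.
have [_ [fin1 sum1]] := integral01 g mf1 f101.
have -> : (\int[g]_z (v z.1)%:E = \int[g]_z (1 - f1 z)%:E)%E.
  by apply: eq_integral => z _; rewrite /f1 subKr.
have -> : (\int[g]_z \int[trans m z]_y (v y)%:E = \int[g]_z (f2 z)%:E)%E.
  by apply: eq_integral => z _; rewrite f2E.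
rewrite -(leeD2lE _ _ fin1) sum1.
by apply: le_trans (leeD i1 i2); rewrite -EFinD lee_fin.
Qed.

Lemma limit_measure_invariant B : measurable B ->
  g (fst @^-1` B) = (\int[g]_z trans m z B)%E.
Proof.
have [_ normX GdeltaX] := metrizable_separation metX.
pose mu := image_probability (@measurable_fst _ _ X A) g.
pose nu := image_probability measurable_snd (pprod_kernel g (trans m)).
have nuE C : measurable C -> nu C = (\int[g]_z trans m z C)%E.
  by move=> mC; apply: eq_integral => z _; rewrite xsectionE.
(* Two probability measures of which one is the smaller are equal: compare on
   [B] and on its complement. *)
have munu : forall C, measurable C -> (mu C <= nu C)%E.
  apply: (le_measure_continuous GdeltaX normX) => v cv v01.
  have mvE : measurable_fun [set: X] (fun x => (v x)%:E).
    by apply/measurable_EFinP; exact: continuous_borel.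
  have v0 x : (0 <= (v x)%:E)%E by rewrite lee_fin; case/andP: (v01 x).
  rewrite [leLHS]ge0_integral_image_probability//.
  rewrite [leRHS]ge0_integral_image_probability//.
  rewrite [leRHS]ge0_integral_pprod_kernel//; last exact: measurableT_comp mvE measurable_snd.
  exact: (limit_measure_test cv v01).
move=> mB; rewrite -nuE//; apply/eqP; rewrite eq_le.
rewrite [X in X && _](munu _ mB)/=.
have := munu _ (measurableC mB).
rewrite [X in (X <= _)%E -> _](probability_setC mu)//.
rewrite [X in (_ <= X)%E -> _](probability_setC nu)//.
have mufin := fin_num_measure mu _ mB; have nufin := fin_num_measure nu _ mB.
rewrite -(fineK mufin) -(fineK nufin) -!EFinB !lee_fin => h.
have : (nu B <= mu B)%E by rewrite -(fineK mufin) -(fineK nufin) lee_fin; lra.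
by [].
Qed.

(** [limit_integral_le] gives lower bounds, so it is applied to [1 - T / c],
    where [T] is the cost truncated at [c]; its superlevel sets are sublevel sets
    of the cost. *)
Lemma limit_measure_truncated_cost N :
  (\int[g]_z truncated_cost m N.+1%:R z <= s%:E)%E.
Proof.
set c : R := N.+1%:R.
have c0 : 0 < c by exact: ltr0n.
have mT := measurable_truncated_cost m c.
have T0 z : (0 <= truncated_cost m c z)%E by apply: truncated_cost_ge0; exact: ltW.
have Tc z : (truncated_cost m c z <= c%:E)%E by rewrite ge_min lexx orbT.
have Tfin z : truncated_cost m c z \is a fin_num.
  by rewrite ge0_fin_numE// (le_lt_trans (Tc z))// ltry.
pose f z := 1 - c^-1 * fine (truncated_cost m c z).
have fE z : ((1 - f z)%:E = c^-1%:E * truncated_cost m c z)%E.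
  by rewrite /f subKr EFinM fineK.
have f01 z : 0 <= f z <= 1.
  have h0 : 0 <= c^-1 * fine (truncated_cost m c z).
    by apply: mulr_ge0; [rewrite invr_ge0 ltW|exact: fine_ge0].
  have h1 : c^-1 * fine (truncated_cost m c z) <= 1.
    by rewrite ler_pdivrMl// mulr1 -lee_fin fineK.
  by rewrite /f subr_ge0 h1/= gerBl.
have mf : measurable_fun [set: X * A] f.
  apply: measurable_funB => //; apply: measurable_funM => //.
  apply/measurable_EFinP; rewrite (_ : _ \o _ = truncated_cost m c)//.
  by apply/funext => z /=; rewrite fineK.
pose l : R := lim (fine (\int[gam n]_z (f z)%:E)%E @[n --> U]).
have cl : fine (\int[gam n]_z (f z)%:E)%E @[n --> U] --> l.
  apply: (bounded_ultra_cvg ultraU (a := 0) (b := 1)) => n.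
  by have [] := integral01 (gam n) mf f01.
have il : (l%:E <= \int[g]_z (f z)%:E)%E.
  apply: (limit_integral_le ultraU mf f01) cl => t t0.
  apply: gE; first exact: measurable_superlevel.
  move=> D cD _ lsc.
  rewrite (_ : [set z | t <= f z] = [set z | (cost m z <= (c * (1 - t))%:E)%E]).
    exact: closed_cost_le.
  have fle z : (t <= f z) = (truncated_cost m c z <= (c * (1 - t))%:E)%E.
    rewrite -[in RHS](fineK (Tfin z)) lee_fin -ler_pdivrMl// /f.
    by rewrite !lerBrDr addrC.
  have cr : (c%:E <= (c * (1 - t))%:E)%E = false.
    by apply/negbTE; rewrite -ltNge lte_fin gtr_pMr//; lra.
  by apply/seteqP; split=> z /=; rewrite fle ge_min cr orbF.
have intT (P : probability (X * A)%type R) :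
    (\int[P]_z (1 - f z)%:E = c^-1%:E * \int[P]_z truncated_cost m c z)%E.
  under eq_integral do rewrite fE.
  by rewrite ge0_integralZl// lee_fin invr_ge0 ltW.
have ls : 1 <= l + c^-1 * s.
  have cls : fine (\int[gam n]_z (f z)%:E)%E + c^-1 * (s + 2 * n.+1%:R^-1) @[n --> U]
      --> l + c^-1 * (s + 2 * 0).
    apply: cvgD => //; apply: cvgM; first exact: cvg_cst.
    apply: cvgD; first exact: cvg_cst.
    by apply: cvgM; [exact: cvg_cst|exact: cvg_inv].
  rewrite mulr0 addr0 in cls.
  apply: (ler_cvg_to (cvg_cst (1 : R)) cls); apply: ooU; exists N => // n /= Nn.
  have [_ [fin sum1]] := integral01 (gam n) mf f01.
  rewrite -lee_fin EFinD fineK// -sum1; apply: leeD2l.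
  rewrite intT EFinM; apply: lee_wpmul2l; first by rewrite lee_fin invr_ge0 ltW.
  apply: le_trans (gam_cost n); apply: ge0_le_integral => //.
  - exact: measurable_truncated_cost.
  - move=> z _; rewrite le_min ge_min lexx/=; apply: (le_trans (Tc z)).
    by rewrite lee_fin ler_nat ltnS.
have [_ [fin sum1]] := integral01 g mf f01.
have : (c^-1%:E * \int[g]_z truncated_cost m c z <= (c^-1 * s)%:E)%E.
  rewrite -intT -(leeD2lE _ _ fin) sum1; apply: (@le_trans _ _ (l%:E + (c^-1 * s)%:E)%E).
    by rewrite -EFinD lee_fin.
  exact: leeD2r.
by rewrite EFinM lee_pmul2l// lte_fin invr_gt0.
Qed.

Lemma limit_measure_cost : (\int[g]_z cost m z <= s%:E)%E.
Proof.
have cvgT z : truncated_cost m N.+1%:R z @[N --> \oo] --> cost m z.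
  rewrite /truncated_cost; case: (cost m z) (cost_ge0 m z) => [r| |]// _.
    apply: cvg_near_cst; apply: filterS (nbhs_infty_ger r) => n rn.
    by rewrite min_l// lee_fin (le_trans rn)// ler_nat.
  apply/cvgeyPge => b; apply: filterS (nbhs_infty_ger b) => n bn.
  by rewrite min_r ?leey// lee_fin (le_trans bn)// ler_nat.
have ndT (z : X * A) : [set: X * A] z ->
    {homo (fun N => truncated_cost m N.+1%:R z) : i j / (i <= j)%N >-> (i <= j)%E}.
  move=> _ i j ij; rewrite le_min !ge_min lexx/= lee_fin ler_nat ltnS ij.
  by rewrite orbT.
have := @cvg_monotone_convergence _ _ R g setT measurableT
  (fun N => truncated_cost m N.+1%:R)
  (fun N => measurable_truncated_cost m N.+1%:R)
  (fun N z _ => truncated_cost_ge0 m (ler0n R N.+1) z) ndT.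
rewrite (eq_integral (cost m)); last by move=> z _; exact/cvg_lim.
move/cvge_to_le; apply.
by apply: filterE => N; exact: limit_measure_truncated_cost.
Qed.

End limit_measure.

End limit_occupation.

(** * Linear programming duality *)
Section optimal_occupation.
Context (R : realType) (dX dA : measure_display).
Context (X : borelType dX) (A : borelType dA) (m : mdp R X A).
Hypothesis metX : metrizable R X.
Hypothesis countA : countable [set: A].
Hypothesis discA : forall B : set A, open B.
Variable K : nat -> set (X * A).
Hypothesis hSU : condSU m K.
Hypothesis hM : condM m K.
Local Open Scope ereal_scope.

Lemma primal_feasible_probability (g : probability (X * A)%type R) :
  g (graph m) = 1 ->
  (forall B, measurable B -> g (fst @^-1` B) = \int[g]_z trans m z B) ->
  \int[g]_z cost m z < +oo ->
  primal_feasible m g /\ primal_value m g = \int[g]_z cost m z.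
Proof.
move=> gG ginv gcost.
have mG := graph_measurable m.
have gGC : g (~` graph m) = 0 by rewrite probability_setC// gG subee.
have intG F : measurable_fun [set: X * A] F -> (forall z, 0 <= F z) ->
    \int[g]_(z in graph m) F z = \int[g]_z F z.
  move=> mF F0; rewrite [RHS](ge0_negligible_integral (N := ~` graph m))//.
    by rewrite setTD setCK.
  exact: measurableC.
have mc := @cost_measurable _ _ _ _ _ m.
split; last by rewrite /primal_value intG//; exact: cost_ge0.
split=> //.
- split=> //; rewrite intG; last 2 first.
  + by apply: emeasurable_funD.
  + by move=> z; rewrite adde_ge0 ?cost_ge0.
  rewrite ge0_integralD//; last by move=> z _; exact: cost_ge0.
  by rewrite integral1_probability lte_add_pinfty// ltry.
- move=> B mB; rewrite intG//; first exact: ginv.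
  exact: measurable_kernel.
Qed.

(** Passing to the limit along a free ultrafilter in [near_optimal_occupation]. *)
Lemma primal_attains_sup_dual : sup_dual m < +oo ->
  exists2 g : {finite_measure set (X * A)%type -> \bar R},
    primal_feasible m g & primal_value m g <= sup_dual m.
Proof.
move=> supoo.
have sup0 : 0 <= sup_dual m.
  by apply: ereal_sup_ubound; exists (0, cst 0)%R => //; exact: dual_feasible0.
have supfin : sup_dual m \is a fin_num by rewrite ge0_fin_numE.
pose s := fine (sup_dual m).
have sE : sup_dual m = s%:E by rewrite /s fineK.
have [e eA] := countable_enumeration countA.
have /choice[gam gamP] : forall n, exists g : probability (X * A)%type R,
  [/\ g (~` graph m) = 0,
    forall v : X -> R, measurable_fun [set: X] v ->
      (forall x, 0 <= v x <= 1)%R ->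
      \int[g]_z (v z.1)%:E <=
        \int[g]_z \int[trans m z]_y (v y)%:E + (n.+1%:R^-1)%:E &
    \int[g]_z truncated_cost m n.+1%:R z <= (s + 2 * n.+1%:R^-1)%:E].
  by move=> n; apply: near_optimal_occupation eA _ _ _; rewrite sE.
have [U [ultraU ooU]] := ultraFilterLemma eventually_filter.
have gG n : gam n (~` graph m) = 0 by have [] := gamP n.
have gb n := (let: And3 _ h _ := gamP n in h).
have gc n := (let: And3 _ _ h := gamP n in h).
have [g [gF gE]] :=
  limit_measure_exists metX countA discA hSU hM gG gb gc ultraU ooU.
have gcost := limit_measure_cost discA gc ultraU ooU gE.
have [feas val] := primal_feasible_probability
  (limit_measure_graph metX countA discA hSU gc ultraU ooU gF)
  (fun B mB => limit_measure_invariant metX discA gb ultraU ooU gF gE mB)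
  (le_lt_trans gcost (ltry s)).
by exists g => //; rewrite val sE.
Qed.

End optimal_occupation.

Theorem theorem3p1 (R : realType) (dX dA : measure_display)
    (X : borelType dX) (A : borelType dA)
    (hX : borel_space R X)
    (hAcountable : countable [set: A])
    (hAdiscrete : forall B : set A, open B)
    (m : mdp R X A)
    (hG : condG m)
    (Gamma_ : nat -> set (X * A))
    (hSU : condSU m Gamma_)
    (hM : condM m Gamma_) :
  [/\ (exists g, primal_feasible m g),
      (exists g, primal_optimal m g) &
      (exists rh, dual_feasible m rh)] /\
  (inf_primal m = sup_dual m /\ sup_dual m = optimal_average_cost m).
Proof.
have [_ metX _] := hX.
have supoo : (sup_dual m < +oo)%E.
  have [pi [zeta Joo]] := hG; apply: le_lt_trans Joo.
  by apply: ge_ereal_sup => _ [[rho h] /dual_feasible_le_average_cost + <-].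
have [g feas gs] := primal_attains_sup_dual metX hAcountable hAdiscrete hSU hM supoo.
have sup_le_opt := sup_dual_le_optimal_average_cost m.
have opt_le g' (feas' : primal_feasible m g') :=
  optimal_average_cost_le_primal hAcountable hAdiscrete feas'.
have gopt : primal_optimal m g.
  split=> // g' feas'; apply: (le_trans gs); apply: (le_trans sup_le_opt).
  exact: opt_le.
have sup_opt : sup_dual m = optimal_average_cost m.
  by apply/eqP; rewrite eq_le sup_le_opt (le_trans (opt_le _ feas) gs).
split; first split.
- by exists g.
- by exists g.
- by exists (0, cst 0); exact: dual_feasible0.
split=> //; apply/eqP; rewrite eq_le; apply/andP; split.
  by apply: le_trans gs; apply: ereal_inf_lbound; exists g.
by apply: le_ereal_inf_tmp => _ [g' feas' <-]; rewrite sup_opt; exact: opt_le.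
Qed.
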